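(* For every integer $k\ge1$ there is a polynomial $f_k$ in $k$ variables with rational coefficients such that the following holds. Let $g(x)=x+\sum_{n\ge2}a_nx^n$ be real-analytic near $0$, with potential $$G(x)=\int_0^xg(\xi)\,d\xi=\tfrac12x^2+\sum_{n\ge3}\frac{a_{n-1}}{n}x^n=\tfrac12x^2+G_1(x)+G_2(x),$$ where $G_1(x)=\sum_{k\ge2}\frac{a_{2k-2}}{2k-1}x^{2k-1}$ is odd and $G_2(x)=\sum_{k\ge2}\frac{a_{2k-1}}{2k}x^{2k}$ is even. If the equation $\ddot x+g(x)=0$ has an isochronous center at $0$, then $$a_{2k+1}=f_k(a_{2k},a_{2k-2},\dots,a_2)\qquad\text{for all }k\ge1.$$ In particular, if $G$ is isochronous, then $G_2\equiv0$ is equivalent to $G_1\equiv0$, i.e. to $G(x)=\frac12x^2$ being harmonic.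
   Context: The equation $\ddot x+g(x)=0$ is identified with the planar system $\dot x=y$, $\dot y=-g(x)$. The center at the origin is called isochronous (and $G$ is then called an isochronous potential) if all periodic orbits near $(0,0)$ have the same minimal period (which is then $2\pi$). *)

(* Defs.v *)
(* Stdlib reals with Coquelicot; multivariate polynomials come from MathComp,
   through the canonical ring structure of [R] provided by [Rstruct]. *)
From mathcomp Require Import all_boot all_order all_algebra.
From mathcomp Require Import Rstruct.
From mathcomp Require Import mpoly.
From Stdlib Require Import Reals.
From Coquelicot Require Import Coquelicot.

Set Implicit Arguments.
Unset Strict Implicit.
Unset Printing Implicit Defensive.

Local Open Scope R_scope.

Definition rat_poly_eval (k : nat) (p : {mpoly rat[k]}) (v : 'I_k -> R) : R :=
  (map_mpoly (ratr : rat -> R) p).@[v]%R.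

Definition is_solution (g x y : R -> R) : Prop :=
  forall t : R, is_derive x t (y t) /\ is_derive y t (- g (x t)).

Definition is_period (x y : R -> R) (T : R) : Prop :=
  0 < T /\ forall t : R, x (t + T) = x t /\ y (t + T) = y t.

Definition is_minimal_period (x y : R -> R) (T : R) : Prop :=
  is_period x y T /\ forall S : R, is_period x y S -> T <= S.

(* Equilibria are not periodic orbits. *)
Definition is_periodic_orbit (g x y : R -> R) : Prop :=
  [/\ is_solution g x y,
      ~ (forall t : R, x t = x 0 /\ y t = y 0)
    & exists T : R, is_period x y T].

Definition is_center (g : R -> R) : Prop :=
  g 0 = 0 /\
  exists delta : R, 0 < delta /\
    forall x0 y0 : R, 0 < x0 ^ 2 + y0 ^ 2 < delta ^ 2 ->
      exists x y : R -> R, [/\ is_periodic_orbit g x y, x 0 = x0 & y 0 = y0].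

Definition is_isochronous_center (g : R -> R) : Prop :=
  is_center g /\
  exists eps T : R, 0 < eps /\
    forall x y : R -> R, is_periodic_orbit g x y ->
      (forall t : R, x t ^ 2 + y t ^ 2 < eps ^ 2) -> is_minimal_period x y T.

(* Analytic germs at the origin: [g] is arbitrary away from [0]. *)
Definition analytic_germ (a : nat -> R) (g : R -> R) : Prop :=
  locally 0 (fun x : R => is_pseries a x (g x)).

Definition germ_eq (u v : R -> R) : Prop := locally 0 (fun x : R => u x = v x).

Definition potential (g : R -> R) (x : R) : R := RInt g 0 x.

(* In the next two series, the summation index [j] stands for [k - 2]. *)
(* In the next two series, the summation index [j] stands for [k - 2]. *)
Definition G1 (a : nat -> R) (x : R) : R :=
  Series (fun j : nat =>
    a (2 * j + 2)%nat / INR (2 * j + 3)%nat * x ^ (2 * j + 3)%nat).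

Definition G2 (a : nat -> R) (x : R) : R :=
  Series (fun j : nat =>
    a (2 * j + 3)%nat / INR (2 * j + 4)%nat * x ^ (2 * j + 4)%nat).

(* Main.v *)
(** In the coordinates u = sgn(x) sqrt(2 G(x)), y, orbits are circles u = c sin theta,
    y = c cos theta run with speed theta' = 1 / X'(u), where X is the inverse of
    x |-> u. Hence the period of the orbit of energy c^2/2 is the integral of
    X'(c sin theta) over [0, 2 pi]. If it does not depend on c, the even part of
    X' - 1 has no leading Taylor coefficient: X(u) = u + S(u) with S even to all
    orders. Comparing coefficients in G(u + S(u)) = u^2/2 then determines
    successively, and polynomially over Q, the coefficients of S and those a_n with
    n odd from the a_n with n even. If G_2 = 0 and s is the lowest coefficient of S,
    of order M, the coefficient of u^(2M) is s^2/2 - (M+1) s^2, whence s = 0. *)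
Require Import Defs.
From mathcomp Require Import all_boot all_order all_algebra.
From mathcomp Require Import Rstruct.
From mathcomp Require Import mpoly.
From mathcomp Require ring.
From Stdlib Require Import Reals Lra.
From Coquelicot Require Import Coquelicot.
Local Open Scope R_scope.

(** * Formal computation *)

(** The same recursion is run twice: over polynomials in the unknowns a_2, ..., a_(2k), where it
    produces f_k, and over R with the actual coefficients. Hence it uses only ring operations, takes
    1/2 as a parameter [h], and leaves the choice of the next coefficient to a [rule] that may look
    at the current defect; ring morphisms then carry one run to the other. Step m concerns degree m
    + 3 in G and degree m + 2 in X. Thus odd m means an even degree in G, a coefficient a_n with n =
    m + 2 odd, and an odd degree in X, where isochrony forbids any correction.

    On the analytic side, nothing beyond a continuous first derivative of X is established. The
    polynomial of the formal run almost solves G(X(u)) = u^2 / 2, and the stability of this equation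
    makes its derivative agree with X' up to any prescribed power of u. That estimate is all the
    period argument needs. *)

Section NormalPair.
Import GRing.Theory mathcomp.algebra_tactics.ring.
Local Open Scope ring_scope.

(* Truncations [(G, X)] of a potential and of the solution [X(u)] of
   [G(X(u)) = h u^2]. The step [m] adds the coefficient [b] of [x^(m+3)] to [G],
   where [b] may depend on the coefficient [c] of [u^(m+3)] in [G(X(u))], and
   corrects the coefficient of [u^(m+2)] in [X] accordingly (for [h = 1/2]). *)
Fixpoint normal_pair (A : comNzRingType) (h : A) (rule : nat -> A -> A) (m : nat) :
    {poly A} * {poly A} :=
  if m is m'.+1 then
    let p := normal_pair A h rule m' in
    let c := (p.1 \Po p.2)`_m'.+3 in
    let b := rule m' c in
    (p.1 + b *: 'X^(m'.+3), p.2 - (c + b) *: 'X^(m'.+2))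
  else (h *: 'X^2, 'X).

Definition defect (A : comNzRingType) (p : {poly A} * {poly A}) (m : nat) : A :=
  (p.1 \Po p.2)`_m.+3.

(** Each step consists of sums, products, compositions and coefficient extractions, all of which
    commute with ring morphisms. *)
Lemma map_normal_pair (A B : comNzRingType) (phi : {rmorphism A -> B}) (h : A)
    (ruleA : nat -> A -> A) (ruleB : nat -> B -> B) (m : nat) :
  (forall i c, phi (ruleA i c) = ruleB i (phi c)) ->
  normal_pair B (phi h) ruleB m =
  (map_poly phi (normal_pair A h ruleA m).1, map_poly phi (normal_pair A h ruleA m).2).
Proof.
move=> Hr; elim: m => [|m IH] /=; first by rewrite map_polyZ map_polyXn map_polyX.
rewrite IH /= -map_comp_poly coef_map -Hr.
congr pair; first by rewrite rmorphD /= map_polyZ map_polyXn.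
by rewrite rmorphB /= map_polyZ map_polyXn rmorphD.
Qed.

(** The rules are compared only at the defects actually reached. This lets the coefficients of an
    isochronous potential, given in advance, be recognized as a run of a rule that computes them
    from the defects. *)
Lemma eq_normal_pair (A : comNzRingType) (h : A) (rule1 rule2 : nat -> A -> A) (m : nat) :
  (forall i, (i < m)%nat -> let c := defect A (normal_pair A h rule1 i) i in
     rule1 i c = rule2 i c) ->
  normal_pair A h rule1 m = normal_pair A h rule2 m.
Proof.
elim: m => //= m IH Hr; rewrite -IH => [|i im]; last exact: Hr (ltnW im).
by have /= := Hr m (ltnSn m); rewrite /defect => ->.
Qed.

Lemma normal_pair_fst (A : comNzRingType) (b : nat -> A) (m : nat) :
  b 0%nat = 0 -> b 1%nat = 0 ->
  (normal_pair A (b 2%nat) (fun i _ => b i.+3) m).1 = \poly_(i < m.+3) b i.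
Proof.
move=> b0 b1; elim: m => [|m /= ->].
  by apply/polyP => i; rewrite coef_poly coefZ coefXn; case: i => [|[|[|i]]];
    rewrite /= ?b0 ?b1 ?mulr0 ?mulr1.
apply/polyP => i; rewrite coefD !coef_poly coefZ coefXn [in RHS]ltnS [in RHS]leq_eqVlt.
by case: eqP => [->|_] /=; rewrite ?ltnn ?add0r ?mulr1 ?mulr0 ?addr0.
Qed.

Lemma dvdp_comp_sub (F : fieldType) (p y z : {poly F}) : (y - z) %| ((p \Po y) - (p \Po z)).
Proof.
elim/poly_ind: p => [|p c IH]; first by rewrite !comp_poly0 subrr dvdp0.
rewrite !comp_polyD !comp_polyM !comp_polyX !comp_polyC.
have -> : (p \Po y) * y + c%:P - ((p \Po z) * z + c%:P) =
  ((p \Po y) - (p \Po z)) * y + (p \Po z) * (y - z).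
  by move: (p \Po y) (p \Po z) => A B; ring.
by apply: dvdp_add; [exact: dvdp_mulr|exact: dvdp_mull].
Qed.

(** Divisibility by ['X^n] serves throughout as the formal O(u^n). *)
Lemma dvdp_XnP (F : fieldType) (n : nat) (p : {poly F}) :
  reflect (forall i, (i < n)%nat -> p`_i = 0) ('X^n %| p).
Proof.
apply: (iffP idP) => [/dvdpP [q ->] i Hi|H]; first by rewrite coefMXn Hi.
rewrite -(poly_take_drop n p); have -> : take_poly n p = 0.
  by apply/polyP => i; rewrite coef_take_poly coef0; case: ifP => // /H.
by rewrite add0r dvdp_mulIr.
Qed.

Lemma dvdp_Xn_leq (F : fieldType) (k n : nat) (p : {poly F}) :
  (k <= n)%nat -> 'X^n %| p -> 'X^k %| p.
Proof. by move=> kn; apply: dvdp_trans; exact: dvdp_exp2l. Qed.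

(** The difference of powers factors as y - u, of order k + 1, times a sum of products y^(n-i) u^i,
    each of order n because u divides y. *)
Lemma dvdp_exp_sub_X (F : fieldType) (k n : nat) (y : {poly F}) :
  'X^(k.+1) %| (y - 'X) -> 'X^(k + n.+1) %| (y ^+ n.+1 - 'X^(n.+1)).
Proof.
move=> H; have Xy : 'X %| y.
  rewrite -(subrK 'X y) dvdp_add //; apply: dvdp_trans H.
  by rewrite -{1}(expr1 'X) dvdp_exp2l.
rewrite subrXX addnS -addSn exprD; apply: dvdp_mul => //.
rewrite big_seq; apply: (big_ind (fun p => 'X^n %| p)) => [|? ? ? ?|i _].
- exact: dvdp0.
- exact: dvdp_add.
apply: (dvdp_Xn_leq _ _ (n - i + i)); first by rewrite subnK // -ltnS.
by rewrite exprD; apply: dvdp_mul => //; exact: dvdp_exp2r.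
Qed.

Lemma normal_pair_snd_sub_X (A : fieldType) (h : A) (rule : nat -> A -> A) (m : nat) :
  'X^2 %| (normal_pair A h rule m).2 - 'X.
Proof.
elim: m => [|m IH] /=; first by rewrite subrr dvdp0.
rewrite addrAC dvdp_add // dvdpNr -mul_polyC; apply: dvdp_mull.
exact: dvdp_exp2l.
Qed.

Lemma normal_pair_fst_sub (A : fieldType) (h : A) (rule : nat -> A -> A) (m : nat) :
  'X^3 %| (normal_pair A h rule m).1 - h *: 'X^2.
Proof.
elim: m => [|m IH] /=; first by rewrite subrr dvdp0.
rewrite addrAC dvdp_add // -mul_polyC; apply: dvdp_mull.
exact: dvdp_exp2l.
Qed.

(** A correction d of X changes G(X(u)) by 2 h u d = u d to leading order. With d = - (c + b)
    u^(m+2) this cancels the old defect c and the contribution b of the new monomial. *)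
Lemma normal_pair_comp (F : fieldType) (h : F) (rule : nat -> F -> F) (m : nat) :
  h + h = 1 ->
  let p := normal_pair F h rule m in 'X^(m.+3) %| ((p.1 \Po p.2) - h *: 'X^2).
Proof.
move=> hh; elim: m => [|m IH] /=.
  by rewrite comp_polyXr subrr dvdp0.
have H2 := normal_pair_snd_sub_X F h rule m.
have H1 := normal_pair_fst_sub F h rule m.
move: (normal_pair F h rule m) IH H1 H2 => [P Q] /= IH H1 H2.
set c := (P \Po Q)`_m.+3; set b := rule m c.
pose d : {poly F} := - ((c + b) *: 'X^(m.+2)); rewrite -/d.
have Xd : 'X^(m.+2) %| d by rewrite dvdpNr -mul_polyC dvdp_mulIr.
have H2' : 'X^2 %| Q + d - 'X.
  by rewrite addrAC dvdp_add //; apply: dvdp_Xn_leq Xd.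
have XQ : 'X %| Q.
  rewrite -(subrK 'X Q) dvdp_add //; apply: dvdp_trans H2.
  by rewrite -{1}(expr1 'X) dvdp_exp2l.
have XQd : 'X %| Q + d.
  rewrite dvdp_add //; apply: dvdp_trans Xd.
  by rewrite -{1}(expr1 'X) dvdp_exp2l.
(* Splitting off the quadratic part of P isolates the linear response d u; every term involving
   [rho] has order at least m + 4. *)
have [rho Erho] := dvdpP _ _ H1.
have EP : P = h%:P * 'X^2 + rho * 'X^3 by rewrite -Erho -mul_polyC addrC subrK.
have hhP : h%:P + h%:P = 1 :> {poly F} by rewrite -polyCD hh.
have B1 : 'X^(m.+4) %| (P \Po (Q + d)) - (P \Po Q) - d * 'X.
  have -> : (P \Po (Q + d)) - (P \Po Q) - d * 'X =
    d * (Q - 'X) + h%:P * d ^+ 2 +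
    (((rho \Po (Q + d)) - (rho \Po Q)) * (Q + d) ^+ 3 +
     (rho \Po Q) * (d * ((Q + d) ^+ 2 + (Q + d) * Q + Q ^+ 2))).
    rewrite EP !(comp_polyD, comp_polyM, comp_polyC, comp_polyX).
    have -> : d * (Q - 'X) = (h%:P + h%:P) * d * Q - d * 'X by rewrite hhP; ring.
    move: (rho \Po (Q + d)) (rho \Po Q) => A B; ring.
  apply: dvdp_add; apply: dvdp_add.
  - by rewrite -addn2 exprD dvdp_mul.
  - apply: dvdp_mull; rewrite expr2; apply: (dvdp_Xn_leq _ _ (m.+2 + m.+2)).
      by rewrite !addSn !addnS !ltnS leq_addr.
    by rewrite exprD dvdp_mul.
  - apply: (dvdp_Xn_leq _ _ (m.+2 + 3)); first by rewrite !addnS addn0.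
    rewrite exprD dvdp_mul ?dvdp_exp2r //; apply: dvdp_trans Xd _.
    by have := dvdp_comp_sub F rho (Q + d) Q; rewrite [Q + d - Q]addrAC subrr add0r.
  - apply: dvdp_mull; rewrite -addn2 exprD dvdp_mul // !dvdp_add //.
    + exact: dvdp_exp2r.
    + by rewrite expr2 dvdp_mul.
    + exact: dvdp_exp2r.
have B2 : 'X^(m.+4) %| (P \Po Q) - h *: 'X^2 - c *: 'X^(m.+3).
  apply/dvdp_XnP => i; rewrite ltnS leq_eqVlt => /orP [/eqP ->|Hi].
    by rewrite !coefB !coefZ !coefXn eqxx /= mulr0 subr0 mulr1 subrr.
  have /dvdp_XnP IHi := IH; rewrite coefB IHi //.
  by rewrite coefZ coefXn ltn_eqF // mulr0 subr0.
have B3 : 'X^(m.+4) %| (Q + d) ^+ m.+3 - 'X^(m.+3).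
  by rewrite -[m.+4]/(1 + m.+3)%nat; exact: dvdp_exp_sub_X.
have -> : ((P + b *: 'X^(m.+3)) \Po (Q + d)) - h *: 'X^2 =
  ((P \Po (Q + d)) - (P \Po Q) - d * 'X) + ((P \Po Q) - h *: 'X^2 - c *: 'X^(m.+3)) +
  b%:P * ((Q + d) ^+ m.+3 - 'X^(m.+3)).
  have -> : d * 'X = - ((c%:P + b%:P) * 'X^(m.+3)).
    by rewrite /d mulNr -mul_polyC polyCD -mulrA -exprSr.
  rewrite comp_polyD comp_polyZ comp_Xn_poly -!mul_polyC.
  by move: (P \Po (Q + d)) (P \Po Q) ((Q + d) ^+ m.+3) => A B D; ring.
by apply: dvdp_add; [exact: dvdp_add|exact: dvdp_mull].
Qed.

End NormalPair.

(** * The first nonzero coefficient after the quadratic term *)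

Section LeadingCoefficient.
Import GRing.Theory Num.Theory mathcomp.algebra_tactics.ring.
Local Open Scope ring_scope.

Lemma normal_pair_trivial (A : comNzRingType) (h : A) (rule : nat -> A -> A) (m : nat) :
  (forall i, (i < m)%nat -> rule i 0 = 0) -> normal_pair A h rule m = (h *: 'X^2, 'X).
Proof.
elim: m => //= m IH Hr; rewrite IH => [/=|i im]; last exact: Hr (ltnW im).
by rewrite comp_polyXr coefZ coefXn /= mulr0 Hr // addr0 scale0r scale0r addr0 subr0.
Qed.

Lemma size_normal_pair_snd (A : comNzRingType) (h : A) (rule : nat -> A -> A) (m : nat) :
  (size (normal_pair A h rule m).2 <= m.+2)%nat.
Proof.
elim: m => [|m IH] /=; first by rewrite size_polyX.
apply: leq_trans (size_polyD _ _) _; rewrite geq_max size_polyN (leqW IH) /=.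
by apply: leq_trans (size_scale_leq _ _) _; rewrite size_polyXn.
Qed.

Lemma normal_pair_snd_stable (F : fieldType) (h : F) (rule : nat -> F -> F) (k m : nat) :
  (k <= m)%nat -> 'X^(k.+2) %| (normal_pair F h rule m).2 - (normal_pair F h rule k).2.
Proof.
elim: m => [|m IH]; first by rewrite leqn0 => /eqP ->; rewrite subrr dvdp0.
rewrite leq_eqVlt => /orP [/eqP ->|km]; first by rewrite subrr dvdp0.
rewrite [normal_pair F h rule m.+1]/= [X in _ %| X]addrAC.
apply: dvdp_add; first exact: IH.
by rewrite dvdpNr -mul_polyC dvdp_mull // dvdp_exp2l.
Qed.

(** First-order Taylor formula with remainder of order D^2 u^j. Passing from j to j + 1 multiplies
    the remainder by u + D and adds (j + 2) D^2 u^(j+1). *)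
Lemma dvdp_exp_sub_linear (F : fieldType) (M j : nat) (D : {poly F}) :
  'X^(M.+1) %| D ->
  'X^(M.+1 + M.+1 + j) %| ('X + D) ^+ j.+2 - 'X^(j.+2) - j.+2%:R * 'X^(j.+1) * D.
Proof.
move=> HD; have HD2 : 'X^(M.+1 + M.+1) %| D ^+ 2 by rewrite exprD expr2 dvdp_mul.
elim: j => [|j IH].
  rewrite addn0; have -> : ('X + D) ^+ 2 - 'X^2 - 2%:R * 'X^1 * D = D ^+ 2 by ring.
  exact: HD2.
have XD : 'X %| 'X + D.
  rewrite dvdp_add //; apply: dvdp_trans HD.
  by rewrite -{1}(expr1 'X) dvdp_exp2l.
have -> : ('X + D) ^+ j.+3 - 'X^(j.+3) - j.+3%:R * 'X^(j.+2) * D =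
  (('X + D) ^+ j.+2 - 'X^(j.+2) - j.+2%:R * 'X^(j.+1) * D) * ('X + D) +
  j.+2%:R * (D ^+ 2 * 'X^(j.+1)).
  rewrite [('X + D) ^+ j.+3]exprSr.
  have -> : 'X^(j.+3) = 'X^(j.+1) * 'X * 'X :> {poly F} by rewrite -!exprSr.
  have -> : 'X^(j.+2) = 'X^(j.+1) * 'X :> {poly F} by rewrite -exprSr.
  rewrite -[j.+3%:R]natr1.
  by move: (('X + D) ^+ j.+2) (j.+2%:R : {poly F}) ('X^(j.+1) : {poly F}) => A n Y; ring.
rewrite addnS; apply: dvdp_add; first by rewrite exprSr dvdp_mul.
by apply: dvdp_mull; rewrite -addnS exprD dvdp_mul.
Qed.

(* If [b (K + 3)] is the first coefficient after [b 2], the coefficient of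
   [u ^ (2 K + 4)] in [G(X(u))] is [s ^ 2 / 2 - (K + 3) s ^ 2], [s = - b (K + 3)]. *)
Lemma normal_pair_leading (F : numFieldType) (b : nat -> F) (K : nat) :
  b 0%nat = 0 -> b 1%nat = 0 -> b 2%nat + b 2%nat = 1 ->
  (forall i, (i < K)%nat -> b i.+3 = 0) ->
  let m := (K + K).+1 in
  defect F (normal_pair F (b 2%nat) (fun i _ => b i.+3) m) m = 0 -> b K.+3 = 0.
Proof.
move=> b0 b1 bb bK m.
set rule := fun (i : nat) (_ : F) => b i.+3; set h := b 2%nat.
set s := - b K.+3.
have EK : (normal_pair F h rule K.+1).2 = 'X + s *: 'X^(K.+2).
  rewrite /= normal_pair_trivial => [/=|i iK]; last exact: bK.
  by rewrite comp_polyXr coefZ coefXn /= mulr0 add0r scaleNr.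
have Km : (K.+1 <= m)%nat by rewrite ltnS leq_addr.
have Hst := normal_pair_snd_stable F h rule K.+1 m Km.
have Hsz := size_normal_pair_snd F h rule m.
rewrite /defect normal_pair_fst // -/rule -/h.
set Q := (normal_pair F h rule m).2 in Hst Hsz *.
pose D := Q - 'X; have EQ : Q = 'X + D by rewrite addrC subrK.
have XD : 'X^(K.+2) %| D.
  have -> : D = Q - ('X + s *: 'X^(K.+2)) + s *: 'X^(K.+2) by rewrite opprD addrA subrK.
  rewrite -EK dvdp_add //; first exact: dvdp_Xn_leq Hst.
  by rewrite -mul_polyC dvdp_mulIr.
have lowD i : (i < K.+2)%nat -> D`_i = 0 by move/dvdp_XnP: XD => H /H.
have DK : D`_K.+2 = s.
  have /dvdp_XnP/(_ K.+2 (ltnSn _)) := Hst; rewrite EK opprD addrA coefB -/D.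
  by rewrite coefZ coefXn eqxx mulr1 => /eqP; rewrite subr_eq0 => /eqP.
(* After m steps X has degree at most m + 1, so the cross term 2 u D does not reach degree m + 3 = 2
   (K + 2) in Q^2; only D^2 does, with coefficient s^2. *)
have topD : D`_m.+2 = 0.
  rewrite coefB coefX /= subr0 nth_default //.
have coefQ2 : (Q ^+ 2)`_m.+3 = s ^+ 2.
  have [E HE] := dvdpP _ _ XD.
  have E0 : E`_0 = s by rewrite -DK HE coefMXn ltnn subnn.
  have -> : Q ^+ 2 = 'X^2 + (D * 'X + D * 'X) + D ^+ 2 by rewrite EQ; ring.
  rewrite !coefD coefXn coefMX /= topD !add0r HE exprMn -exprM coefMXn.
  have -> : (K.+2 * 2 = m.+3)%nat by rewrite muln2 -addnn /m !addSn !addnS.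
  by rewrite ltnn subnn expr2 coef0M E0 expr2.
(* Only the linear term (j + 3) u^(j+2) D counts in degree m + 3. It calls for the coefficient of D
   in degree 2 K + 2 - j, which is s for j = K and lies below the order of D for j > K. *)
have coefQ j : (j.+3 < m.+3)%nat -> (K <= j)%nat -> (Q ^+ j.+3)`_m.+3 = if j == K then s *+ K.+3 else 0.
  move=> jm Kj.
  have /dvdp_XnP/(_ m.+3) := dvdp_exp_sub_linear F K.+1 j.+1 D XD.
  have -> : (m.+3 < K.+2 + K.+2 + j.+1)%nat.
    by rewrite /m !addSn !addnS !ltnS leq_addr.
  rewrite -EQ => /(_ isT) /eqP; rewrite !coefB coefXn gtn_eqF // subr0 subr_eq0 => /eqP ->.
  rewrite -mulrA mulr_natl coefMn mulrC coefMXn ltnNge ltnW /=; last exact: ltnW jm.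
  have -> : (m.+3 - j.+2 = K.+2 + K - j)%nat by rewrite /m !subSS !addSn.
  case: eqP => [->|/eqP jK]; first by rewrite addnK DK.
  rewrite lowD ?mul0rn // ltn_subLR; last first.
    have jKK : (j <= K + K)%nat by move: jm; rewrite /m !ltnS.
    by rewrite !addSn; do 2!apply: leqW.
  by rewrite addnC ltn_add2r ltn_neqAle eq_sym jK.
rewrite poly_def.
have -> : ((\sum_(i < m.+3) b i *: 'X^i) \Po Q)`_m.+3 = \sum_(i < m.+3) b i * (Q ^+ i)`_m.+3.
  rewrite raddf_sum coef_sum; apply: eq_bigr => i _ /=.
  by rewrite comp_polyZ comp_Xn_poly coefZ.
have K2 : (2 < m.+3)%nat by [].
have K3 : (K.+3 < m.+3)%nat by rewrite !ltnS leq_addr.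
rewrite (bigD1 (Ordinal K2)) //= (bigD1 (Ordinal K3)) //= big1 => [|[i im] /=]; last first.
  rewrite -!(inj_eq val_inj) /= => /andP [i2 iK].
  case: i im i2 iK => [|[|[|j]]] im //= _; rewrite ?b0 ?b1 ?mul0r // => jK.
  case: (ltnP j K) => [jlt|Kj]; first by rewrite bK // mul0r.
  by rewrite coefQ // ifN ?mulr0 // -(eqSS j) -(eqSS j.+1) -(eqSS j.+2).
rewrite addr0 coefQ2 coefQ // eqxx => E0.
(* The relation h s^2 - (K + 3) s^2 = 0, doubled to remove h, reads (2 K + 5) s^2 = 0 up to sign. *)
have {}E0 : s ^+ 2 * (K.+2 + K.+3)%:R = 0.
  have Eb : b K.+3 = - s by rewrite opprK.
  have : h * s ^+ 2 + h * s ^+ 2 = s ^+ 2 by rewrite -mulrDl bb mul1r.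
  move: E0; rewrite Eb -[s *+ _]mulr_natr natrD -[K.+3%:R]natr1.
  move: (K.+2%:R : F) => n E0 E1.
  have -> : s ^+ 2 * (n + (n + 1)) = s ^+ 2 * (n + (n + 1)) +
     (h * s ^+ 2 + - s * (s * (n + 1))) + (h * s ^+ 2 + - s * (s * (n + 1))) by rewrite E0 !addr0.
  rewrite -[RHS](subrr (s ^+ 2)) -[in X in _ = X - _]E1; ring.
move/eqP: E0; rewrite mulf_eq0 pnatr_eq0 addSn orbF expf_eq0 /= oppr_eq0.
by move/eqP.
Qed.

End LeadingCoefficient.

Definition series_rule (b : nat -> R) (i : nat) (_ : R) : R := b i.+3.

Definition series_pair (b : nat -> R) (m : nat) : {poly R} * {poly R} :=
  normal_pair R (b 2%nat) (series_rule b) m.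

(** * The universal polynomials over Q and their evaluation *)

Section UniversalPolynomials.
Import GRing.Theory.

(* The potential whose [X(u) - u] is even: its coefficients of odd degree are
   [e n * q (n + 1)], where [q n] stands for [1 / n], and those of even degree
   are such that [X] needs no correction. *)
Definition isochronous_rule (A : comNzRingType) (e q : nat -> A) (i : nat) (c : A) : A :=
  if odd i then GRing.opp c else GRing.mul (e i.+2) (q i.+3).

Local Open Scope ring_scope.

(* [a_n] for even [n]: the variables are ordered as [a_(2k), ..., a_2]. *)
Definition even_variable (k n : nat) : {mpoly rat[k]} :=
  if insub (k - n./2)%nat is Some i then 'X_i else 0.

Definition inverse_const (k n : nat) : {mpoly rat[k]} := ((n%:R)^-1)%:MP.

Definition universal_pair (k m : nat) : {poly {mpoly rat[k]}} * {poly {mpoly rat[k]}} :=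
  normal_pair _ (inverse_const k 2) (isochronous_rule _ (even_variable k) (inverse_const k)) m.

(** Step 2 k - 1 fixes the coefficient a_(2k+1) / (2k+2) of x^(2k+2), which isochrony forces to be
    minus the defect; the factor 2 k + 2 clears the denominator. *)
Definition isochronous_poly (k : nat) : {mpoly rat[k]} :=
  - ((2 * k).+2%:R * defect _ (universal_pair k (2 * k).-1) (2 * k).-1).

Lemma map_defect (A B : comNzRingType) (phi : {rmorphism A -> B})
    (p : {poly A} * {poly A}) (m : nat) :
  defect B (map_poly phi p.1, map_poly phi p.2) m = phi (defect A p m).
Proof. by rewrite /defect /= -map_comp_poly coef_map. Qed.

Lemma eval_inverse_const (k n : nat) (v : 'I_k -> R) :
  rat_poly_eval (inverse_const k n) v = Rinv (INR n).
Proof.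
by rewrite /rat_poly_eval /inverse_const map_mpolyC mevalC /= fmorphV rmorph_nat INRE RinvE.
Qed.

Lemma eval_even_variable (k j : nat) (a : nat -> R) : (0 < j <= k)%nat ->
  rat_poly_eval (even_variable k (2 * j)) (fun i : 'I_k => a (2 * (k - i))%nat) = a (2 * j)%nat.
Proof.
move=> /andP [j0 jk]; rewrite /even_variable mul2n doubleK.
have lt : (k - j < k)%nat by rewrite ltn_subrL j0 (leq_trans j0 jk).
rewrite insubT /rat_poly_eval map_mpolyX mevalXU /= subKn //.
by rewrite mul2n.
Qed.

(** Evaluation is a ring morphism, and the two hypotheses on [b] say that the real coefficients obey
    [isochronous_rule] below m. The bound m < 2 k ensures that no even-indexed coefficient beyond
    a_(2k) is called for. *)
Lemma eval_universal_defect (k m : nat) (a : nat -> R) (b : nat -> R) :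
  (m < 2 * k)%nat -> b 2%nat = Rinv (INR 2) ->
  (forall i, (i < m)%nat -> ~~ odd i -> b i.+3 = a i.+2 * Rinv (INR i.+3)) ->
  (forall i, (i < m)%nat -> odd i -> b i.+3 = - defect R (series_pair b i) i) ->
  rat_poly_eval (defect _ (universal_pair k m) m) (fun i : 'I_k => a (2 * (k - i))%nat) =
  defect R (series_pair b m) m.
Proof.
move=> mk b2 beven bodd; set v := fun i : 'I_k => _.
pose phi : {rmorphism {mpoly rat[k]} -> R} := meval v \o map_mpoly (ratr : rat -> R).
have Ephi p : rat_poly_eval p v = phi p by [].
rewrite Ephi -map_defect; congr (defect R _ m).
pose rule := isochronous_rule R (phi \o even_variable k) (phi \o inverse_const k).
rewrite -(map_normal_pair _ _ phi _ _ rule); last first.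
  by move=> i c; rewrite /rule /isochronous_rule; case: ifP => _; rewrite ?rmorphN ?rmorphM.
have phiq n : phi (inverse_const k n) = Rinv (INR n) by exact: eval_inverse_const.
suff E : series_pair b m = normal_pair R (b 2%nat) rule m by rewrite E b2 -phiq.
apply: eq_normal_pair => i im /=.
rewrite -/(series_pair b i) /series_rule /rule /isochronous_rule.
case: ifPn => oi; first exact: bodd.
rewrite beven //; congr GRing.mul; last by symmetry; exact: phiq.
have Ei : i.+2 = (2 * i./2.+1)%nat.
  by rewrite mulnS mul2n -[in LHS](odd_double_half i) (negbTE oi).
rewrite Ei; symmetry; apply: eval_even_variable => /=.
rewrite -(leq_pmul2l (isT : (0 < 2)%nat)) -Ei.
exact: leq_ltn_trans im mk.
Qed.

End UniversalPolynomials.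

(** * Periods *)

Lemma derive_gap (f df : R -> R) (m x y : R) :
  (forall z, is_derive f z (df z)) -> (forall z, m <= df z) ->
  x <= y -> m * (y - x) <= f y - f x.
Proof.
move=> Hf Hm Hxy.
case: (MVT_gen f x y df) => [z _|z _|z [_ ->]].
- exact: Hf.
- by apply: derivable_continuous_pt; exists (df z); apply/is_derive_Reals.
- by apply: Rmult_le_compat_r; [lra|exact: Hm].
Qed.

(** The uniform lower bound on the derivative gives an inverse on the whole line, so no domains have
    to be tracked. It is applied both to time as a function of the angle and to the coordinate u. *)
Lemma inverse_C1 (f df : R -> R) (m : R) :
  0 < m -> (forall x, is_derive f x (df x)) -> (forall x, continuous df x) ->
  (forall x, m <= df x) ->
  exists h : R -> R, [/\ forall y, f (h y) = y, forall x, h (f x) = x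
    & forall y, is_derive h y (/ df (h y))].
Proof.
move=> Hm Hf Hc Hdf.
have gap := fun x y => derive_gap f df m x y Hf Hdf.
have cf : continuity f.
  by move=> z; apply: derivable_continuous_pt; exists (df z); apply/is_derive_Reals.
have surj : forall y, {x | f x = y}.
  (* Growth at rate at least m makes f (- b) and f b enclose y. *)
  move=> y; pose b := Rabs (y - f 0) / m.
  have Hb : m * b = Rabs (y - f 0) by rewrite /b; field; lra.
  have Hb0 : 0 <= b by apply: Rdiv_le_0_compat => //; apply: Rabs_pos.
  have H1 := gap 0 b Hb0.
  have H2 : m * (0 - - b) <= f 0 - f (- b) by apply: gap; lra.
  have H3 := Rle_abs (y - f 0).
  have H4 := Rle_abs (- (y - f 0)); rewrite Rabs_Ropp in H4.
  case: (IVT_gen f (- b) b y cf) => [|x [_ Hx]]; last by exists x.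
  rewrite Rmin_left ?Rmax_right; nra.
pose h y := proj1_sig (surj y).
have fh : forall y, f (h y) = y by move=> y; rewrite /h; case: (surj y).
have inj : forall x z, f x = f z -> x = z.
  move=> x z E; case: (Rle_or_lt x z) => H.
    have := gap _ _ H; rewrite E; nra.
  have := gap _ _ (Rlt_le _ _ H); rewrite E; nra.
exists h; split=> // [x|y]; first exact: inj.
apply/is_derive_Reals => eps Heps.
have ci : continuous (fun x => / df x) (h y).
  by apply: continuous_comp; [exact: Hc|apply: continuous_Rinv; have := Hdf (h y); lra].
have [d Hd] := proj1 (filterlim_locally _ _) ci (mkposreal eps Heps).
(* The inverse is Lipschitz with constant 1 / m, so an increment below d m moves it by less than
   d. *)
have dm : 0 < d * m by apply: Rmult_lt_0_compat => //; apply: cond_pos.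
exists (mkposreal _ dm) => k Hk0 /= Hk.
set x := h y; set x' := h (y + k).
have Ex : f x = y by exact: fh.
have Ex' : f x' = y + k by exact: fh.
have Hxx : m * Rabs (x' - x) <= Rabs k.
  case: (Rle_or_lt x x') => H.
    have := gap _ _ H; rewrite Ex Ex' => H1.
    have H2 : 0 <= m * (x' - x) by apply: Rmult_le_pos; lra.
    by rewrite !Rabs_right; lra.
  have := gap _ _ (Rlt_le _ _ H); rewrite Ex Ex' => H1.
  have H2 : 0 < m * (x - x') by apply: Rmult_lt_0_compat; lra.
  by rewrite !Rabs_left; lra.
case: (MVT_gen f x x' df) => [z _|z _|z [Hz E]].
- exact: Hf.
- exact: cf.
have Hzx : Rabs (z - x) < d.
  have : Rabs (z - x) <= Rabs (x' - x).
    move: Hz; rewrite /Rmin /Rmax; case: Rle_dec => H Hz.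
      by rewrite !Rabs_right; lra.
    by rewrite !Rabs_left1; lra.
  have := cond_pos d; nra.
have -> : (x' - x) / k = / df z.
  have := Hdf z; rewrite Ex Ex' in E => Hz'.
  have E' : k = df z * (x' - x) by lra.
  have nz : x' - x <> 0 by move=> E2; apply: Hk0; rewrite E' E2 Rmult_0_r.
  by rewrite E'; field; lra.
exact: (Hd z Hzx).
Qed.

Lemma derive_lipschitz (f df : R -> R) (M x y : R) :
  (forall z, is_derive f z (df z)) -> (forall z, Rabs (df z) <= M) ->
  Rabs (f y - f x) <= M * Rabs (y - x).
Proof.
move=> Hf HM; case: (MVT_gen f x y df) => [z _|z _|z [_ ->]].
- exact: Hf.
- by apply: derivable_continuous_pt; exists (df z); apply/is_derive_Reals.
- by rewrite Rabs_mult; apply: Rmult_le_compat_r; [exact: Rabs_pos|exact: HM].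
Qed.

Lemma cos_lt_1 (x : R) : 0 < x < 2 * PI -> cos x < 1.
Proof.
move=> Hx; have -> : x = 2 * (x / 2) by lra.
have := sin_gt_0 (x / 2); rewrite cos_2a_sin; nra.
Qed.

Lemma continuous_comp_sin (F : R -> R) (c s : R) :
  (forall u, continuous F u) -> continuous (fun s => F (c * sin s)) s.
Proof.
move=> HF; apply: (continuous_comp (fun s => c * sin s) F); last exact: HF.
by apply: (ex_derive_continuous (fun s => c * sin s)); auto_derive.
Qed.

(* In the coordinates [u = c sin theta], [y = c cos theta] the orbit of energy
   [c ^ 2 / 2] satisfies [X'(c sin theta) theta' = 1]: the time is the primitive
   of [X'(c sin theta)], and the period its increment over [2 PI]. *)
Lemma orbit_of_angle (g X dX : R -> R) (r c : R) :
  (forall u, is_derive X u (dX u)) -> (forall u, continuous dX u) ->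
  (forall u, / 2 <= dX u <= 2) -> X 0 = 0 ->
  (forall u, Rabs u < r -> g (X u) * dX u = u) -> 0 < c < r ->
  exists x y : R -> R, [/\ is_periodic_orbit g x y,
    forall t, x t ^ 2 + y t ^ 2 <= 5 * c ^ 2
    & forall T, is_minimal_period x y T ->
        T = RInt (fun s => dX (c * sin s)) 0 (2 * PI)].
Proof.
move=> HX HdX bdX X0 Hg Hc.
pose w s := dX (c * sin s); pose Phi th := RInt w 0 th.
have cw s : continuous w s by exact: continuous_comp_sin.
have ew a b : ex_RInt w a b by apply: ex_RInt_continuous => z _; exact: cw.
have dPhi th : is_derive Phi th (w th).
  apply: is_derive_RInt; last exact: cw.
  by apply: filter_forall => z; apply: RInt_correct.
have Phi0 : Phi 0 = 0 by rewrite /Phi RInt_point.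
have wm s : / 2 <= w s by case: (bdX (c * sin s)).
(* The speed depends on the angle only through its sine, so each full turn takes the same time. *)
have PhiT th : Phi (th + 2 * PI) = Phi th + Phi (2 * PI).
  rewrite /Phi -(RInt_Chasles w 0 (2 * PI) (th + 2 * PI)) //.
  have E := RInt_comp_lin w 1 (2 * PI) 0 th (ew _ _).
  rewrite Rmult_0_r Rplus_0_l Rmult_1_l in E; rewrite -E Rplus_comm.
  congr Rplus; apply: RInt_ext => s _.
  by rewrite /scal /= /mult /= !Rmult_1_l /w sin_plus sin_2PI cos_2PI; congr dX; ring.
case: (inverse_C1 Phi w (/ 2)) => // [|th [Pth thP dth]]; first lra.
have th0 : th 0 = 0 by rewrite -Phi0 thP.
have thT t : th (t + Phi (2 * PI)) = th t + 2 * PI.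
  by rewrite -{1}(Pth t) -PhiT thP.
have mono a b : a <= b -> / 2 * (b - a) <= Phi b - Phi a by exact: (derive_gap Phi w).
have HPI := PI_RGT_0.
have Tpos : 0 < Phi (2 * PI).
  by have := mono 0 (2 * PI); rewrite Phi0; lra.
pose x t := X (c * sin (th t)); pose y t := c * cos (th t).
have csin s : Rabs (c * sin s) <= c.
  by apply: Rabs_le; have := SIN_bound s; nra.
have wnz s : w s <> 0 by have := wm s; lra.
have sol : is_solution g x y.
  move=> t; split.
    have -> : y t = scal (/ w (th t) * (c * cos (th t))) (w (th t)).
      by rewrite /y /scal /= /mult /=; field.
    apply: (is_derive_comp X (fun t => c * sin (th t))); first exact: HX.
    have Hd := is_derive_comp (fun s => c * sin s) th t (c * cos (th t)) _ _ (dth t).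
    by apply: Hd; auto_derive => //; ring.
  have -> : - g (x t) = scal (/ w (th t)) (- (c * sin (th t))).
    have := Hg (c * sin (th t)); rewrite -/(x t) -/(w (th t)) => E.
    rewrite /scal /= /mult /= -[in RHS]E; last by have := csin (th t); lra.
    by field.
  have Hd := is_derive_comp (fun s => c * cos s) th t (- (c * sin (th t))) _ _ (dth t).
  by apply: Hd; auto_derive => //; ring.
have per : is_period x y (Phi (2 * PI)).
  split=> // t; rewrite /x /y thT sin_plus cos_plus sin_2PI cos_2PI.
  by split; [congr X|]; ring.
exists x, y; split.
- split=> //; last by exists (Phi (2 * PI)).
  move=> /(_ (Phi (PI / 2))) [_]; rewrite /y thP th0 cos_PI2 cos_0; lra.
- move=> t; have Hx : Rabs (x t) <= 2 * c.
    have := derive_lipschitz X dX 2 0 (c * sin (th t)) HX.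
    rewrite X0 !Rminus_0_r -/(x t) => H.
    have := csin (th t); have : Rabs (x t) <= 2 * Rabs (c * sin (th t)).
      by apply: H => z; have := bdX z => Hz; rewrite Rabs_right; lra.
    lra.
  have Hy : y t ^ 2 <= c ^ 2.
    apply: pow_maj_Rabs; apply: Rabs_le; rewrite /y; have := COS_bound (th t); nra.
  have Hx2 : x t ^ 2 <= (2 * c) ^ 2 by apply: pow_maj_Rabs.
  lra.
move=> T [[T0 HT] minT]; apply: Rle_antisym; first exact: minT per.
(* Conversely, y returns to its maximum c only when the angle is a multiple of 2 PI, and at time T >
   0 the angle is positive; hence at least one full turn has been made. *)
have H0 : 0 < th T.
  case: (Rlt_or_le 0 (th T)) => // H.
  by have := mono _ _ H; rewrite Pth Phi0; lra.
have C1 : cos (th T) = 1.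
  have [_] := HT 0; rewrite Rplus_0_l /y th0 cos_0 => E.
  by apply: (Rmult_eq_reg_l c); lra.
case: (Rlt_or_le (th T) (2 * PI)) => H.
  by have := cos_lt_1 (th T); lra.
by have := mono _ _ H; rewrite Pth /Phi -/w; lra.
Qed.

(** As c tends to 0 the integrand tends uniformly to F 0 = 1. The tolerance eps / (4 PI) costs eps /
    2 over an interval of length 2 PI. *)
Lemma constant_period_limit (F : R -> R) (T d : R) :
  (forall u, continuous F u) -> F 0 = 1 -> 0 < d ->
  (forall c, 0 < c < d -> RInt (fun s => F (c * sin s)) 0 (2 * PI) = T) ->
  T = 2 * PI.
Proof.
move=> cF F0 Hd HT; have HPI := PI_RGT_0.
apply: cond_eq => eps Heps.
have He : 0 < eps / (4 * PI) by apply: Rdiv_lt_0_compat; lra.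
have [e He'] := proj1 (filterlim_locally _ _) (cF 0) (mkposreal _ He).
have ep := cond_pos e.
pose c := Rmin e d / 2.
have [c0 ce cd] : [/\ 0 < c, c < e & c < d].
  by rewrite /c /Rmin; case: Rle_dec => ?; split; lra.
have near1 s : Rabs (F (c * sin s) - 1) < eps / (4 * PI).
  rewrite -F0; apply: (He' (c * sin s)).
  rewrite /ball /= /AbsRing_ball /= /abs /minus /plus /opp /= Ropp_0 Rplus_0_r.
  by apply: Rabs_def1; have := SIN_bound s; nra.
have ex (h : R -> R) : (forall s, continuous h s) -> ex_RInt h 0 (2 * PI).
  by move=> H; apply: ex_RInt_continuous => z _; exact: H.
have exF := ex _ (fun s => continuous_comp_sin F c s cF).
have exK k := ex (fun _ => k) (fun s => continuous_const k s).
have lo : RInt (fun _ => 1 - eps / (4 * PI)) 0 (2 * PI) <= T.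
  rewrite -(HT c); last by lra.
  apply: RInt_le => //; first lra.
  by move=> s _; have /Rabs_def2 := near1 s; lra.
have hi : T <= RInt (fun _ => 1 + eps / (4 * PI)) 0 (2 * PI).
  rewrite -(HT c); last by lra.
  apply: RInt_le => //; first lra.
  by move=> s _; have /Rabs_def2 := near1 s; lra.
move: lo hi; rewrite !RInt_const /scal /= /mult /=.
have -> : (2 * PI - 0) * (1 - eps / (4 * PI)) = 2 * PI - eps / 2 by field; lra.
have -> : (2 * PI - 0) * (1 + eps / (4 * PI)) = 2 * PI + eps / 2 by field; lra.
move=> ? ?; apply: Rabs_def1; lra.
Qed.

(** Since sin (s + PI) = - sin s, the second half of the orbit folds onto the first: the period sees
    only the even part of F, at arguments of one sign. *)
Lemma RInt_comp_sin_fold (F : R -> R) (c : R) :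
  (forall u, continuous F u) ->
  RInt (fun s => F (c * sin s)) 0 (2 * PI) =
  RInt (fun s => F (c * sin s) + F (- (c * sin s))) 0 PI.
Proof.
move=> cF; pose w s := F (c * sin s).
have cw s : continuous w s by exact: continuous_comp_sin.
have ew a b : ex_RInt w a b by apply: ex_RInt_continuous => z _; exact: cw.
have E := RInt_comp_lin w 1 PI 0 PI (ew _ _).
rewrite Rmult_0_r Rplus_0_l Rmult_1_l -double in E.
have E2 : RInt (fun s => F (- (c * sin s))) 0 PI = RInt w PI (2 * PI).
  rewrite -E; apply: RInt_ext => s _.
  rewrite /scal /= /mult /= !Rmult_1_l /w neg_sin; congr F; ring.
rewrite -/w -(RInt_Chasles w 0 PI (2 * PI)) // -E2 -RInt_plus //.
apply: ex_RInt_continuous => z _.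
apply: (continuous_ext (fun s => F ((- c) * sin s))) => [s|].
  by congr F; ring.
exact: continuous_comp_sin.
Qed.

(* A nonzero leading term would give [F u + F (- u) - 2] a constant sign for
   small [u > 0], although its averages along the orbits vanish. *)
Lemma constant_period_even_part (F : R -> R) (T kappa C d : R) (p : nat) :
  (forall u, continuous F u) -> F 0 = 1 -> 0 < d ->
  (forall c, 0 < c < d -> RInt (fun s => F (c * sin s)) 0 (2 * PI) = T) ->
  (forall u, 0 < u < d ->
     Rabs (F u + F (- u) - 2 - kappa * u ^ p) <= C * u ^ p.+1) ->
  kappa = 0.
Proof.
move=> cF F0 Hd HT HC; have HPI := PI_RGT_0.
case: (Req_dec kappa 0) => // nz; exfalso.
have kp := Rabs_pos_lt _ nz.
have C0 := Rabs_pos C.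
have q0 : 0 < Rabs kappa / (Rabs C + 1) by apply: Rdiv_lt_0_compat; lra.
(* For 0 < u <= c the error C u^(p+1) stays strictly below |kappa| u^p. *)
pose c := Rmin (Rabs kappa / (Rabs C + 1)) d / 2.
have [c0 cq cd] : [/\ 0 < c, c < Rabs kappa / (Rabs C + 1) & c < d].
  by rewrite /c /Rmin; case: Rle_dec => ?; split; lra.
have [sg [sgk sg1]] : exists sg, sg * kappa = Rabs kappa /\ Rabs sg <= 1.
  case: (Rle_or_lt 0 kappa) => H.
    by exists 1; rewrite !Rabs_right; lra.
  by exists (-1); rewrite !Rabs_left; lra.
pose k s := F (c * sin s) + F (- (c * sin s)).
have ck s : continuous k s.
  apply: (continuous_plus (fun s => F (c * sin s)) (fun s => F (- (c * sin s)))).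
    exact: continuous_comp_sin.
  apply: (continuous_ext (fun s => F ((- c) * sin s))) => [t|].
    by congr F; ring.
  exact: continuous_comp_sin.
have c2 s : continuous (fun _ : R => 2) s by exact: continuous_const.
pose h s := sg * (k s - 2).
have ch s : continuous h s.
  apply: (continuous_scal_r sg (fun s => k s - 2)).
  exact: (continuous_minus k (fun _ => 2)).
have ex (f : R -> R) : (forall s, continuous f s) -> ex_RInt f 0 PI.
  by move=> H; apply: ex_RInt_continuous => z _; exact: H.
have h0 : RInt h 0 PI = 0.
  rewrite (RInt_scal (fun s => k s - 2)); last first.
    by apply: ex => s; exact: (continuous_minus k (fun _ => 2)).
  rewrite (RInt_minus k (fun _ => 2)); try exact: ex.
  rewrite -RInt_comp_sin_fold // HT // (constant_period_limit F T d) //.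
  rewrite RInt_const /scal /minus /plus /opp /= /mult /=; ring.
suff : 0 < RInt h 0 PI by rewrite h0; lra.
apply: RInt_gt_0 => // s Hs.
  have s0 := sin_gt_0 s (proj1 Hs) (proj2 Hs).
  have u0 : 0 < c * sin s by apply: Rmult_lt_0_compat.
  have uc : c * sin s <= c by have := SIN_bound s; nra.
  rewrite /h /k; move: (c * sin s) u0 uc => u u0 uc.
  have Hu : 0 < u < d by lra.
  have := HC u Hu; have up := pow_lt u p u0.
  set D := F u + F (- u) - 2 => H.
  have H1 : Rabs (sg * (D - kappa * u ^ p)) <= C * u ^ p.+1.
    rewrite Rabs_mult; have := Rabs_pos (D - kappa * u ^ p); nra.
  have := Rle_abs (- (sg * (D - kappa * u ^ p))); rewrite Rabs_Ropp.
  have -> : sg * (D - kappa * u ^ p) = sg * D - sg * kappa * u ^ p by ring.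
  rewrite sgk => H2.
  have H3 : C * u < Rabs kappa.
    have := Rle_abs C; have : (Rabs C + 1) * u < Rabs kappa.
      have -> : Rabs kappa = (Rabs C + 1) * (Rabs kappa / (Rabs C + 1)) by field; lra.
      apply: Rmult_lt_compat_l; lra.
    nra.
  have : 0 < u ^ p * (Rabs kappa - C * u) by apply: Rmult_lt_0_compat; lra.
  move: H1; have -> : C * u ^ p.+1 = u ^ p * (C * u) by rewrite /=; ring.
  have -> : sg * (D - kappa * u ^ p) = sg * D - sg * kappa * u ^ p by ring.
  rewrite sgk; lra.
Qed.

(** * The coordinate u *)

Lemma ball_RE (x y e : R) : ball x e y <-> Rabs (y - x) < e.
Proof. by []. Qed.

Lemma ex_pseries_CV_radius (a : nat -> R) (x : R) :
  x <> 0 -> ex_pseries a x -> Rbar_lt 0 (CV_radius a).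
Proof.
move=> x0 Hx; apply: (Rbar_lt_le_trans _ (Rabs x)); first exact: Rabs_pos_lt.
apply: Rbar_not_lt_le => /CV_disk_outside; apply.
apply: (is_lim_seq_ext (fun n => scal (pow_n x n) (a n))) => [n|].
  by rewrite pow_n_pow /scal /= /mult /= Rmult_comm.
exact: ex_series_lim_0.
Qed.

Lemma CV_radius_pos_R (a : nat -> R) : Rbar_lt 0 (CV_radius a) ->
  exists rho : R, 0 < rho /\ forall x, Rabs x <= rho -> Rbar_lt (Rabs x) (CV_radius a).
Proof.
case: (CV_radius a) => [c||] //= Hc; last by exists 1; split; [lra|].
by exists (c / 2); split=> [|x Hx]; lra.
Qed.

Lemma analytic_germ_PSeries (a : nat -> R) (g : R -> R) : analytic_germ a g ->
  exists rho : R, 0 < rho /\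
    forall x, Rabs x <= rho -> Rbar_lt (Rabs x) (CV_radius a) /\ g x = PSeries a x.
Proof.
move=> [d Hd]; have dp := cond_pos d.
have rad : Rbar_lt 0 (CV_radius a).
  apply: (ex_pseries_CV_radius a (d / 2)); first lra.
  exists (g (d / 2)); apply: Hd; apply/ball_RE.
  by rewrite Rminus_0_r Rabs_right; lra.
have [rho [rho0 Hrho]] := CV_radius_pos_R a rad.
exists (Rmin rho (d / 2)); split=> [|x Hx]; first by apply: Rmin_glb_lt; lra.
have Hx1 := Rmin_l rho (d / 2); have Hx2 := Rmin_r rho (d / 2).
split; first by apply: Hrho; lra.
symmetry; apply: is_pseries_unique; apply: Hd; apply/ball_RE.
by rewrite Rminus_0_r; lra.
Qed.

Lemma is_derive_PS_Int (a : nat -> R) (x : R) : Rbar_lt (Rabs x) (CV_radius a) ->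
  is_derive (PSeries (PS_Int a)) x (PSeries a x).
Proof.
move=> Hx.
have -> : PSeries a x = PSeries (PS_derive (PS_Int a)) x.
  apply: PSeries_ext => n; rewrite /PS_derive /PS_Int.
  by field; apply: not_0_INR.
by apply: is_derive_PSeries; rewrite CV_radius_Int.
Qed.

(* [V x] is [x * sqrt (2 * G x / x ^ 2)] near [0], extended to the whole line
   with its derivative kept in [[1/2, 2]]. *)
Lemma normalizing_coordinate (a : nat -> R) (g : R -> R) :
  a 0%nat = 0 -> a 1%nat = 1 -> analytic_germ a g ->
  exists (V dV : R -> R) (r : R), [/\ 0 < r, V 0 = 0, dV 0 = 1 &
    [/\ forall x, is_derive V x (dV x), forall x, continuous dV x,
        forall x, / 2 <= dV x <= 2 &
        forall x, Rabs x < r -> V x * dV x = g x /\ V x ^ 2 = 2 * PSeries (PS_Int a) x]].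
Proof.
move=> a0 a1 /analytic_germ_PSeries [rho [rho0 Hrho]].
(* The first two coefficients of the integrated series vanish, so dropping them divides by x^2: [W]
   is 2 G(x) / x^2. *)
pose b := PS_Int a; pose w := PS_scal 2 (PS_decr_1 (PS_decr_1 b)).
pose W := PSeries w; pose dW := PSeries (PS_derive w).
have radw : CV_radius w = CV_radius a.
  by rewrite CV_radius_scal ?CV_radius_decr_1 ?CV_radius_Int //; lra.
have GW x : Rabs x <= rho -> 2 * PSeries b x = x ^ 2 * W x.
  move=> /Hrho [Hx _]; rewrite PSeries_decr_1; last first.
    by apply: CV_radius_inside; rewrite CV_radius_Int.
  rewrite (PSeries_decr_1 (PS_decr_1 b)); last first.
    by apply: CV_radius_inside; rewrite CV_radius_decr_1 CV_radius_Int.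
  rewrite /W PSeries_scal [b 0%nat]/b [PS_decr_1 b 0%nat]/PS_decr_1 /b /PS_Int a0 /=; field.
have W0 : W 0 = 1.
  rewrite /W PSeries_0 /w /PS_scal /PS_decr_1 /b /PS_Int a1 /scal /= /mult /=; field.
have dWx x : Rabs x <= rho -> is_derive W x (dW x).
  by move=> /Hrho [Hx _]; apply: is_derive_PSeries; rewrite radw.
have cdW x : Rabs x <= rho -> continuous dW x.
  move=> /Hrho [Hx _]; apply/continuity_pt_filterlim; apply: PSeries_continuity.
  by rewrite CV_radius_derive radw.
have abs0 : Rabs 0 <= rho by rewrite Rabs_R0; lra.
have half : 0 < / 2 by lra.
have cW x : Rabs x <= rho -> continuous W x.
  by move=> Hx; apply: ex_derive_continuous; exists (dW x); exact: dWx.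
have [r1 Hr1] := proj1 (filterlim_locally _ _) (cW 0 abs0) (mkposreal _ half).
pose R0 := Rmin rho r1; have R00 : 0 < R0 by apply: Rmin_glb_lt => //; exact: cond_pos.
have Rrho x : Rabs x < R0 -> Rabs x <= rho by have := Rmin_l rho r1; rewrite -/R0; lra.
have Wpos x : Rabs x < R0 -> 0 < W x.
  move=> Hx; have Hx1 : ball 0 r1 x.
    by apply/ball_RE; rewrite Rminus_0_r; have := Rmin_r rho r1; rewrite -/R0; lra.
  by have := Hr1 x Hx1; move/ball_RE => /=; rewrite W0 => /Rabs_def2; lra.
pose U x := x * sqrt (W x).
pose dU x := sqrt (W x) + x * (dW x / (2 * sqrt (W x))).
have dUx x : Rabs x < R0 -> is_derive U x (dU x).
  move=> Hx; have HW := dWx x (Rrho x Hx); have Wp := Wpos x Hx.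
  have HS : is_derive (fun x => sqrt (W x)) x (dW x / (2 * sqrt (W x))).
    exact: is_derive_sqrt.
  have := is_derive_mult (fun x => x) _ x _ _ (is_derive_id x) HS Rmult_comm.
  by rewrite /dU /plus /mult /one /= Rmult_1_l.
have cdU x : Rabs x < R0 -> continuous dU x.
  move=> Hx; have Wp := Wpos x Hx; have sp := sqrt_lt_R0 _ Wp.
  have cS : continuous (fun x => sqrt (W x)) x.
    apply: continuous_comp; [exact: cW (Rrho x Hx)|exact: continuous_sqrt].
  apply: (continuous_plus (fun x => sqrt (W x))) => //.
  apply: (continuous_mult (fun x => x)); first exact: continuous_id.
  apply: (continuous_mult dW); first exact: cdW (Rrho x Hx).
  apply: continuous_comp; last by apply: continuous_Rinv; lra.
  by apply: (continuous_scal_r 2 (fun x => sqrt (W x))).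
have dU0 : dU 0 = 1 by rewrite /dU W0 sqrt_1; lra.
have cdU0 : continuous dU 0 by apply: cdU; rewrite Rabs_R0.
have [r2 Hr2] := proj1 (filterlim_locally _ _) cdU0 (mkposreal _ half).
pose r := Rmin R0 r2 / 2.
have [r0 rR rr2] : [/\ 0 < r, r < R0 & r < r2].
  by have := cond_pos r2; rewrite /r /Rmin; case: Rle_dec => ? ?; split; lra.
(* Clamping the argument of [dU] to [-r, r] and integrating extends U to the line while keeping the
   derivative within 1/2 of 1. *)
pose cl x := Rmax (- r) (Rmin r x).
have clb x : Rabs (cl x) <= r.
  apply: Rabs_le; rewrite /cl.
  have := Rmin_l r x; have := Rmax_l (- r) (Rmin r x).
  by have : Rmax (- r) (Rmin r x) <= r by apply: Rmax_lub; [|have := Rmin_l r x]; lra.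
have clid x : Rabs x < r -> cl x = x.
  move/Rabs_def2 => ?; rewrite /cl Rmin_right ?Rmax_right //; lra.
have lmin p q : Rabs (Rmin r p - Rmin r q) <= Rabs (p - q).
  by rewrite /Rmin; do !case: Rle_dec => ?; rewrite /Rabs; do !case: Rcase_abs => ?; lra.
have lmax p q : Rabs (Rmax (- r) p - Rmax (- r) q) <= Rabs (p - q).
  by rewrite /Rmax; do !case: Rle_dec => ?; rewrite /Rabs; do !case: Rcase_abs => ?; lra.
have ccl x : continuous cl x.
  apply/filterlim_locally => e; exists e => y /ball_RE Hy; apply/ball_RE.
  apply: Rle_lt_trans Hy; apply: Rle_trans (lmax _ _) (lmin _ _).
pose dV x := dU (cl x); pose V x := RInt dV 0 x.
have cdV x : continuous dV x.
  by apply: continuous_comp; [exact: ccl|apply: cdU; have := clb x; lra].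
have dVx x : is_derive V x (dV x).
  apply: is_derive_RInt; last exact: cdV.
  apply: filter_forall => z; apply: RInt_correct.
  by apply: ex_RInt_continuous => t _; exact: cdV.
have V0 : V 0 = 0 by rewrite /V RInt_point.
have VU x : Rabs x < r -> V x = U x.
  move=> Hx.
  have Hz z : Rmin 0 x <= z <= Rmax 0 x -> is_derive (fun t => V t - U t) z 0.
    move=> Hz; have Hzr : Rabs z < r.
      move: Hz; have /Rabs_def2 := Hx; rewrite /Rmin /Rmax.
      by case: Rle_dec => ? ? ?; apply: Rabs_def1; lra.
    have -> : 0 = dV z - dU z by rewrite /dV clid //; ring.
    by apply: (is_derive_minus V U); [exact: dVx|apply: dUx; lra].
  case: (MVT_gen (fun t => V t - U t) 0 x (fun _ => 0)) => [z z1|z z1|z [_]].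
  - by apply: Hz; lra.
  - by apply: derivable_continuous_pt; exists 0; apply/is_derive_Reals; exact: Hz.
  by rewrite V0 /U; lra.
exists V, dV, r; split=> //; first by rewrite /dV clid // Rabs_R0.
split=> // x.
  have Hc : ball 0 r2 (cl x) by apply/ball_RE; rewrite Rminus_0_r; have := clb x; lra.
  by have := Hr2 _ Hc; move/ball_RE => /=; rewrite dU0 -/(dV x) => /Rabs_def2; lra.
move=> Hx; have HxR : Rabs x < R0 by lra.
have U2 z : Rabs z < R0 -> U z ^ 2 = 2 * PSeries b z.
  move=> Hz; rewrite GW; last exact: Rrho.
  rewrite /U Rpow_mult_distr; congr Rmult.
  by rewrite pow2_sqrt //; have := Wpos z Hz; lra.
rewrite VU // /dV clid //; split; last exact: U2.
have [Hxa ->] := Hrho x (Rrho x HxR).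
rewrite -(is_derive_unique _ _ _ (is_derive_PS_Int a x Hxa)).
(* Differentiating U^2 / 2 = G gives U U' = g. *)
symmetry; apply: is_derive_unique.
apply: (is_derive_ext_loc (fun z => / 2 * (U z * U z))).
  have gap : 0 < R0 - Rabs x by lra.
  exists (mkposreal _ gap) => z /ball_RE /= Hz.
  have := U2 z; have := Rabs_triang (z - x) x.
  have -> : z - x + x = z by ring.
  move=> H1 H2; have Hz2 : Rabs z < R0 by lra.
  have := H2 Hz2; rewrite /b /=; lra.
have HU := dUx x HxR.
have HUU := is_derive_mult U U x _ _ HU HU Rmult_comm.
have -> : U x * dU x = / 2 * (plus (mult (dU x) (U x)) (mult (U x) (dU x))).
  by rewrite /plus /mult /=; field.
exact: (is_derive_scal (fun z => U z * U z)).
Qed.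

(** * Taylor expansion of X' *)

Lemma locally_and_0 (P Q : R -> Prop) :
  locally 0 P -> locally 0 Q -> locally 0 (fun x => P x /\ Q x).
Proof. exact: filter_and. Qed.

Lemma abs_derive_gap (V dV : R -> R) (m x y : R) :
  (forall z, is_derive V z (dV z)) -> 0 < m -> (forall z, m <= dV z) ->
  m * Rabs (y - x) <= Rabs (V y - V x).
Proof.
move=> HV m0 Hm; case: (Rle_or_lt x y) => H.
  have := derive_gap V dV m x y HV Hm H.
  have : 0 <= m * (y - x) by apply: Rmult_le_pos; lra.
  by move=> ? ?; rewrite !Rabs_right; lra.
have := derive_gap V dV m y x HV Hm (Rlt_le _ _ H).
have : 0 < m * (x - y) by apply: Rmult_lt_0_compat; lra.
by move=> ? ?; rewrite !Rabs_left; lra.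
Qed.

Lemma locally_comp_0 (f : R -> R) (K : R) (Q : R -> Prop) :
  locally 0 (fun u => Rabs (f u) <= K * Rabs u) -> locally 0 Q ->
  locally 0 (fun u => Q (f u)).
Proof.
move=> [d1 H1] [d2 H2].
have Kp : 0 < Rabs K + 1 by have := Rabs_pos K; lra.
have e0 : 0 < Rmin d1 (d2 / (Rabs K + 1)).
  by apply: Rmin_glb_lt; [exact: cond_pos|apply: Rdiv_lt_0_compat => //; exact: cond_pos].
exists (mkposreal _ e0) => u /ball_RE /= Hu; apply: H2; apply/ball_RE.
have l1 := Rmin_l d1 (d2 / (Rabs K + 1)); have l2 := Rmin_r d1 (d2 / (Rabs K + 1)).
have /H1 H : ball 0 d1 u by apply/ball_RE; lra.
rewrite !Rminus_0_r in Hu *; have H3 := Rle_abs K; have H4 := Rabs_pos u.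
have : (Rabs K + 1) * Rabs u < d2.
  have -> : pos d2 = (Rabs K + 1) * (d2 / (Rabs K + 1)) by field; lra.
  by apply: Rmult_lt_compat_l; lra.
nra.
Qed.

(* [V (P u) ^ 2 = 2 G (P u)] is close to [u ^ 2], so [P u] is close to [X u]
   where [V (X u) = u], and then [P'] is close to [X' = 1 / V' (X u)]. *)
Lemma inverse_derivative_approx (V dV X g G P dP : R -> R) (N : nat) :
  (forall x, is_derive V x (dV x)) -> (forall x, / 2 <= dV x <= 2) -> V 0 = 0 ->
  (forall y, V (X y) = y) ->
  locally 0 (fun x => V x * dV x = g x /\ V x ^ 2 = 2 * G x) ->
  locally 0 (fun u => Rabs (P u - u) <= Rabs u / 2) ->
  (exists C, locally 0 (fun u => Rabs (2 * G (P u) - u ^ 2) <= C * Rabs u ^ N.+2)) ->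
  (exists C, locally 0 (fun u => Rabs (g (P u) * dP u - u) <= C * Rabs u ^ N.+1)) ->
  (exists C, locally 0 (fun u => Rabs (dP u) <= C)) ->
  (exists L d, 0 < d /\ forall x y, Rabs x < d -> Rabs y < d ->
     Rabs (g x - g y) <= L * Rabs (x - y)) ->
  exists C, locally 0 (fun u => u <> 0 -> Rabs (/ dV (X u) - dP u) <= C * Rabs u ^ N).
Proof.
move=> HV bV V0 VX Hg HP [C2 H2] [C3 H3] [C4 H4] [L [d [d0 HL]]].
have Vlow z : / 2 <= dV z by case: (bV z).
have half : 0 < / 2 by lra.
have gap x y := abs_derive_gap V dV (/ 2) x y HV half Vlow.
have bX u : Rabs (X u) <= 2 * Rabs u.
  by have := gap 0 (X u); rewrite V0 VX !Rminus_0_r; lra.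
have bP : locally 0 (fun u => Rabs (P u) <= 2 * Rabs u).
  apply: filter_imp HP => u H.
  have := Rabs_triang (P u - u) u; have -> : P u - u + u = P u by ring.
  by have := Rabs_pos u; lra.
have bXl : locally 0 (fun u => Rabs (X u) <= 2 * Rabs u) by exact: filter_forall.
have ld : locally 0 (fun x => Rabs x < d).
  by exists (mkposreal d d0) => x /ball_RE /=; rewrite Rminus_0_r.
have HgP := locally_comp_0 P 2 _ bP Hg.
have HgX := locally_comp_0 X 2 _ bXl Hg.
have ldP := locally_comp_0 P 2 _ bP ld.
have ldX := locally_comp_0 X 2 _ bXl ld.
exists (2 * (C3 + Rabs L * (2 * Rabs C2) * Rabs C4)).
have F1 := locally_and_0 _ _ (locally_and_0 _ _ HgP HgX) (locally_and_0 _ _ ldP ldX).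
have F2 := locally_and_0 _ _ (locally_and_0 _ _ HP H4) (locally_and_0 _ _ (locally_and_0 _ _ H2 H3) F1).
apply: filter_imp F2 => u [[HPu H4u] [[H2u H3u] [[[_ VP] [gX _]] [lP lX]]]] nz.
have u0 := Rabs_pos_lt u nz; have un := pow_lt _ N u0.
rewrite -VP in H2u; rewrite VX in gX.
(* P u, hence V (P u), has the sign of u. Therefore |V (P u) + u| >= |u|, and passing from the
   difference of squares to V (P u) - u costs just one power of u. *)
have sgn : 0 <= V (P u) * u.
  case: (Rle_or_lt 0 u) => Hu.
    have HP0 : 0 <= P u by move: HPu; rewrite (Rabs_right u); [move=> /Rabs_le_between|]; lra.
    by have := derive_gap V dV (/ 2) 0 (P u) HV Vlow HP0; rewrite V0; nra.
  have HP0 : P u <= 0 by move: HPu; rewrite (Rabs_left u); [move=> /Rabs_le_between|]; lra.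
  by have := derive_gap V dV (/ 2) (P u) 0 HV Vlow HP0; rewrite V0; nra.
have VPu : Rabs (V (P u) - u) <= Rabs C2 * Rabs u ^ N.+1.
  have big : Rabs u <= Rabs (V (P u) + u) by apply: Rsqr_le_abs_0; rewrite /Rsqr; nra.
  apply: (Rmult_le_reg_r (Rabs u)) => //.
  apply: (Rle_trans _ (Rabs (V (P u) - u) * Rabs (V (P u) + u))).
    by apply: Rmult_le_compat_l => //; exact: Rabs_pos.
  rewrite -Rabs_mult; have -> : (V (P u) - u) * (V (P u) + u) = V (P u) ^ 2 - u ^ 2 by ring.
  apply: Rle_trans H2u _.
  have -> : Rabs u ^ N.+2 = Rabs u ^ N.+1 * Rabs u by rewrite /=; ring.
  rewrite -Rmult_assoc; apply: Rmult_le_compat_r; first lra.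
  by apply: Rmult_le_compat_r; [apply: pow_le; lra|exact: Rle_abs].
have XP : Rabs (P u - X u) <= 2 * Rabs C2 * Rabs u ^ N.+1.
  by have := gap (X u) (P u); rewrite VX; lra.
set D := / dV (X u) - dP u.
have bVX := bV (X u).
(* Since u V'(X u) = g (X u), this product is u - g (X u) P'(u). Replacing X u by P u uses the
   Lipschitz bound on g; dividing by u at the end is the reason for u <> 0. *)
have ED : dV (X u) * (u * D) = (u - g (P u) * dP u) + (g (P u) - g (X u)) * dP u.
  by rewrite -gX /D; field; lra.
have B1 : Rabs ((g (P u) - g (X u)) * dP u) <=
    Rabs L * (2 * Rabs C2 * Rabs u ^ N.+1) * Rabs C4.
  rewrite Rabs_mult; apply: Rmult_le_compat; try exact: Rabs_pos.
    apply: Rle_trans (HL _ _ lP lX) _.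
    apply: (Rle_trans _ (Rabs L * Rabs (P u - X u))).
      by apply: Rmult_le_compat_r; [exact: Rabs_pos|exact: Rle_abs].
    by apply: Rmult_le_compat_l => //; exact: Rabs_pos.
  by apply: Rle_trans H4u (Rle_abs _).
have B2 : / 2 * (Rabs u * Rabs D) <= Rabs (dV (X u) * (u * D)).
  rewrite !Rabs_mult (Rabs_right (dV (X u))); last lra.
  apply: Rmult_le_compat_r; last lra.
  by apply: Rmult_le_pos; exact: Rabs_pos.
have B3 := Rabs_triang (u - g (P u) * dP u) ((g (P u) - g (X u)) * dP u).
rewrite -ED (Rabs_minus_sym u) in B3.
apply: (Rmult_le_reg_l (Rabs u)) => //.
have -> : Rabs u * (2 * (C3 + Rabs L * (2 * Rabs C2) * Rabs C4) * Rabs u ^ N) =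
  2 * (C3 * Rabs u ^ N.+1 + Rabs L * (2 * Rabs C2 * Rabs u ^ N.+1) * Rabs C4).
  by rewrite /=; ring.
lra.
Qed.

Lemma PSeries_lipschitz (a : nat -> R) : Rbar_lt 0 (CV_radius a) ->
  exists L d, 0 < d /\ forall x y, Rabs x < d -> Rabs y < d ->
    Rabs (PSeries a x - PSeries a y) <= L * Rabs (x - y).
Proof.
move=> Hr; have [rho [rho0 Hrho]] := CV_radius_pos_R a Hr.
have c0 : continuous (PSeries (PS_derive a)) 0.
  apply/continuity_pt_filterlim; apply: PSeries_continuity.
  by rewrite CV_radius_derive Rabs_R0.
have [d1 Hd1] := proj1 (filterlim_locally _ _) c0 (mkposreal 1 Rlt_0_1).
pose M := Rabs (PSeries (PS_derive a) 0) + 1.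
exists M, (Rmin rho d1); split; first by apply: Rmin_glb_lt => //; exact: cond_pos.
move=> x y Hx Hy; have l1 := Rmin_l rho d1; have l2 := Rmin_r rho d1.
have Hz z : Rmin y x <= z <= Rmax y x -> Rabs z < Rmin rho d1.
  move: (Rmin rho d1) Hx Hy => c /Rabs_def2 ? /Rabs_def2 ?; rewrite /Rmin /Rmax.
  by case: Rle_dec => ? ?; apply: Rabs_def1; lra.
have Hd z : Rmin y x <= z <= Rmax y x ->
    is_derive (PSeries a) z (PSeries (PS_derive a) z).
  by move=> /Hz Hz'; apply: is_derive_PSeries; apply: Hrho; lra.
case: (MVT_gen (PSeries a) y x (PSeries (PS_derive a))) => [z z1|z z1|z [zz ->]].
- by apply: Hd; lra.
- apply: derivable_continuous_pt; exists (PSeries (PS_derive a) z).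
  by apply/is_derive_Reals; exact: Hd.
rewrite Rabs_mult; apply: Rmult_le_compat_r; first exact: Rabs_pos.
have Hb : ball 0 d1 z by apply/ball_RE; rewrite Rminus_0_r; have := Hz z zz; lra.
have /ball_RE /= H := Hd1 z Hb.
have := Rabs_triang (PSeries (PS_derive a) z - PSeries (PS_derive a) 0) (PSeries (PS_derive a) 0).
set A := PSeries _ z; set B := PSeries _ 0; have -> : A - B + B = A by ring.
by rewrite /M -/B; rewrite -/A -/B in H; lra.
Qed.

(** * Polynomial and power series estimates near 0 *)

Section Asymptotics.
Import GRing.Theory.
Local Open Scope ring_scope.
Local Open Scope R_scope.

Lemma horner_bounded (p : {poly R}) :
  exists C, forall u, Rabs u <= 1 -> Rabs p.[u] <= C.
Proof.
elim/poly_ind: p => [|p c [C HC]].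
  by exists 0 => u _; rewrite horner0 Rabs_R0; right.
exists (C + Rabs c) => u Hu.
rewrite hornerMXaddC -RplusE -RmultE; apply: Rle_trans (Rabs_triang _ _) _.
apply: Rplus_le_compat_r; rewrite Rabs_mult.
have := HC u Hu; have := Rabs_pos p.[u]; have := Rabs_pos u; nra.
Qed.

Lemma locally_0_lt (d : R) : 0 < d -> locally 0 (fun x => Rabs x < d).
Proof. by move=> d0; exists (mkposreal d d0) => x /ball_RE /=; rewrite Rminus_0_r. Qed.

Lemma horner_bigO (k : nat) (p : {poly R}) : 'X^k %| p ->
  exists C, locally 0 (fun u => Rabs p.[u] <= C * Rabs u ^ k).
Proof.
move=> /dvdpP [q ->]; have [C HC] := horner_bounded q.
exists C; apply: filter_imp (locally_0_lt 1 Rlt_0_1) => u Hu.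
rewrite hornerM hornerXn -RmultE -RpowE Rabs_mult -RPow_abs.
apply: Rmult_le_compat_r; first by apply: pow_le; exact: Rabs_pos.
by apply: HC; lra.
Qed.

Lemma PSeries_bigO (a : nat -> R) (n : nat) : Rbar_lt 0 (CV_radius a) ->
  exists C, locally 0 (fun x =>
    Rabs (PSeries a x - (\poly_(i < n.+1) a i).[x]) <= C * Rabs x ^ n.+1).
Proof.
move=> Hr; have [rho [rho0 Hrho]] := CV_radius_pos_R a Hr.
have Hd : forall n, CV_radius (PS_decr_n a n) = CV_radius a.
  elim=> [|k IH]; first by apply: CV_radius_ext.
  rewrite -IH -[in RHS]CV_radius_decr_1; apply: CV_radius_ext => i.
  by rewrite /PS_decr_1 /PS_decr_n !plusE addSnnS.
have [L [d [d0 HL]]] := PSeries_lipschitz (PS_decr_n a n.+1) ltac:(by rewrite Hd).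
pose B := PSeries (PS_decr_n a n.+1) 0.
exists (Rabs L * d + Rabs B).
have F := locally_and_0 _ _ (locally_0_lt rho rho0) (locally_0_lt d d0).
apply: filter_imp F => x [Hx1 Hx2].
have -> : (\poly_(i < n.+1) a i).[x] = sum_f_R0 (fun k => a k * x ^ k) n.
  rewrite sum_f_R0E horner_poly big_mkord; apply: eq_bigr => i _.
  by rewrite RmultE RpowE.
rewrite (PSeries_decr_n a n); last by apply: CV_radius_inside; apply: Hrho; lra.
set S := sum_f_R0 _ n; set T := PSeries _ x.
have -> : S + x ^ n.+1 * T - S = T * x ^ n.+1 by ring.
rewrite Rabs_mult -RPow_abs; apply: Rmult_le_compat_r.
  by apply: pow_le; exact: Rabs_pos.
have H0 : Rabs 0 < d by rewrite Rabs_R0.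
have := HL x 0 Hx2 H0; rewrite -/T -/B Rminus_0_r => H1.
have := Rabs_triang (T - B) B; have -> : T - B + B = T by ring.
have := Rabs_pos x; have := Rle_abs L; have := Rabs_pos L; nra.
Qed.

Lemma dvdp_Xn_deriv (k : nat) (p : {poly R}) : 'X^(k.+1) %| p -> 'X^k %| p^`().
Proof.
move=> /dvdpP [q ->]; rewrite derivM derivXn /= dvdp_addr.
  by rewrite -mulr_natl; do 2!apply: dvdp_mull.
by rewrite exprS mulrA dvdp_mulIr.
Qed.

(** The bridge between the formal and the analytic side: the formal X meets the hypotheses of
    [inverse_derivative_approx] with N = m + 1. *)
Lemma series_pair_velocity (a : nat -> R) (g V dV X : R -> R) (m : nat) :
  a 0%nat = 0 -> a 1%nat = 1 -> analytic_germ a g ->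
  (forall x, is_derive V x (dV x)) -> (forall x, / 2 <= dV x <= 2) -> V 0 = 0 ->
  (forall y, V (X y) = y) ->
  locally 0 (fun x => V x * dV x = g x /\ V x ^ 2 = 2 * PSeries (PS_Int a) x) ->
  exists C, locally 0 (fun u => u <> 0 ->
    Rabs (/ dV (X u) - (series_pair (PS_Int a) m).2^`().[u]) <= C * Rabs u ^ m.+1).
Proof.
move=> a0 a1 ag HV bV V0 VX Hg.
have [rho [rho0 Hrho]] := analytic_germ_PSeries a g ag.
have rada : Rbar_lt 0 (CV_radius a).
  by have [] := Hrho 0 ltac:(rewrite Rabs_R0; lra); rewrite Rabs_R0.
have b0 : PS_Int a 0%nat = 0 by [].
have b1 : PS_Int a 1%nat = 0 by rewrite /PS_Int a0 /Rdiv Rmult_0_l.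
have bb : (PS_Int a 2%nat + PS_Int a 2%nat) = 1.
  by rewrite /PS_Int a1 /=; change (1 / 2 + 1 / 2 = 1); field.
pose P : {poly R} := \poly_(i < m.+3) PS_Int a i.
have HP1 : (series_pair (PS_Int a) m).1 = P by exact: normal_pair_fst.
have dP : P^`() = \poly_(i < m.+2) a i.
  apply/polyP => i; rewrite coef_deriv !coef_poly ltnS; case: ifP => _; last by rewrite mul0rn.
  rewrite -mulr_natr -INRE -RmultE; change (a i / INR i.+1 * INR i.+1 = a i).
  by field; apply: not_0_INR.
have Hcomp := normal_pair_comp R _ (series_rule (PS_Int a)) m bb.
cbv zeta in Hcomp; rewrite -/(series_pair (PS_Int a) m) HP1 in Hcomp.
have HX := normal_pair_snd_sub_X R (PS_Int a 2%nat) (series_rule (PS_Int a)) m.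
rewrite -/(series_pair (PS_Int a) m) in HX.
set Q := (series_pair (PS_Int a) m).2 in Hcomp HX *.
have [CX HCX] := horner_bigO 2 _ HX.
have HQ : locally 0 (fun u => Rabs (Q.[u] - u) <= Rabs u / 2).
  have e0 : 0 < / (2 * (Rabs CX + 1)).
    by apply: Rinv_0_lt_compat; have := Rabs_pos CX; lra.
  have F := locally_and_0 _ _ HCX (locally_0_lt _ e0).
  apply: filter_imp F => u [H1 H2].
  rewrite hornerD hornerN hornerX -RplusE -RoppE -/(Rminus _ _) in H1.
  apply: Rle_trans H1 _; have cp := Rabs_pos CX; have up := Rabs_pos u.
  have : (Rabs CX + 1) * Rabs u <= / 2.
    have -> : / 2 = (Rabs CX + 1) * / (2 * (Rabs CX + 1)) by field; lra.
    by apply: Rmult_le_compat_l; lra.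
  by have := Rle_abs CX => *; simpl; nra.
have bQ : locally 0 (fun u => Rabs (Q.[u]) <= 2 * Rabs u).
  apply: filter_imp HQ => u H.
  have := Rabs_triang (Q.[u] - u) u; have -> : Q.[u] - u + u = Q.[u] by ring.
  by have := Rabs_pos u; lra.

have [CG HCG] := PSeries_bigO (PS_Int a) m.+2 ltac:(by rewrite CV_radius_Int).
have [CR HCR] := horner_bigO m.+3 _ Hcomp.
(* The estimate for g (Q u) Q'(u) comes from differentiating the polynomial identity, which costs
   one power of u; an analytic O-estimate could not be differentiated. *)
have Hdcomp := dvdp_Xn_deriv _ _ Hcomp.
have [CD HCD] := horner_bigO m.+2 _ Hdcomp.
have [Cg HCg] := PSeries_bigO a m.+1 rada.
have [K HK] := horner_bounded Q^`().
have [L [d [d0 HL]]] := PSeries_lipschitz a rada.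
(* Remainders measured in powers of |Q(u)| become powers of |u| at the cost of 2^k. *)
have pw u k : Rabs Q.[u] <= 2 * Rabs u -> forall C, C * Rabs Q.[u] ^ k <= Rabs C * 2 ^ k * Rabs u ^ k.
  move=> H C; rewrite Rmult_assoc -Rpow_mult_distr.
  apply: (Rle_trans _ (Rabs C * Rabs Q.[u] ^ k)).
    by apply: Rmult_le_compat_r; [apply: pow_le; exact: Rabs_pos|exact: Rle_abs].
  apply: Rmult_le_compat_l; first exact: Rabs_pos.
  by apply: pow_incr; split=> //; exact: Rabs_pos.
apply: (inverse_derivative_approx V dV X g (PSeries (PS_Int a)) (fun u => Q.[u])
  (fun u => Q^`().[u]) m.+1) => //.
- exists (2 * (Rabs CG * 2 ^ m.+3) + 2 * CR).
  have F := locally_and_0 _ _ (locally_and_0 _ _ bQ HCR) (locally_comp_0 _ 2 _ bQ HCG).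
  apply: filter_imp F => u [[H1 H2] H3]; have H4 := pw u m.+3 H1 CG.
  have h2 : PS_Int a 2%nat = / 2 by rewrite /PS_Int a1 /=; change (1 / 2 = / 2); field.
  have E : ((P \Po Q) - PS_Int a 2%nat *: 'X^2).[u] = P.[Q.[u]] - u ^ 2 / 2.
    rewrite hornerD hornerN horner_comp hornerZ hornerXn h2.
    rewrite -RpowE -RplusE -RoppE -RmultE.
    by change (P.[Q.[u]] + - (/ 2 * u ^ 2) = P.[Q.[u]] - u ^ 2 / 2); field.
  rewrite E -/P in H2 H3.
  set G := PSeries _ _ in H3 *.
  have -> : 2 * G - u ^ 2 = 2 * (G - P.[Q.[u]]) + 2 * (P.[Q.[u]] - u ^ 2 / 2) by field.
  apply: Rle_trans (Rabs_triang _ _) _.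
  rewrite !Rabs_mult (Rabs_right 2); last by lra.
  move: (Rabs (G - _)) (Rabs (P.[_] - _)) (Rabs Q.[u] ^ m.+3) (Rabs u ^ m.+3) H2 H3 H4.
  by move: (Rabs CG * 2 ^ m.+3) => *; lra.
- exists (Rabs Cg * 2 ^ m.+2 * Rabs K + CD).
  have F := locally_and_0 _ _ (locally_and_0 _ _ bQ HCD) (locally_comp_0 _ 2 _ bQ HCg).
  have F2 := locally_and_0 _ _ (locally_0_lt 1 Rlt_0_1) (locally_comp_0 _ 2 _ bQ (locally_0_lt rho rho0)).
  apply: filter_imp (locally_and_0 _ _ F F2) => u [[[H1 H2] H3] [H5 H6]].
  have H4 := pw u m.+2 H1 Cg.
  have [_ ->] := Hrho _ (Rlt_le _ _ H6).
  have h2 : PS_Int a 2%nat = / 2 by rewrite /PS_Int a1 /=; change (1 / 2 = / 2); field.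
  have E : ((P \Po Q) - PS_Int a 2%nat *: 'X^2)^`().[u] = P^`().[Q.[u]] * Q^`().[u] - u.
    rewrite derivB deriv_comp derivZ derivXn !hornerE horner_comp h2.
    rewrite -RplusE -RoppE -!RmultE.
    by change (P^`().[Q.[u]] * Q^`().[u] + - (/ 2 * (u + u)) = P^`().[Q.[u]] * Q^`().[u] - u); field.
  rewrite E dP in H2.
  set G := PSeries _ _ in H3 *; set A := (\poly_(i < _) _).[_] in H2 H3.
  set D := Q^`().[u] in H2 *.
  have -> : G * D - u = (G - A) * D + (A * D - u) by ring.
  apply: Rle_trans (Rabs_triang _ _) _; rewrite Rabs_mult.
  have HKu := HK u (Rlt_le _ _ H5); rewrite -/D in HKu.
  have : Rabs (G - A) * Rabs D <= (Rabs Cg * 2 ^ m.+2 * Rabs u ^ m.+2) * Rabs K.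
    apply: Rmult_le_compat; try exact: Rabs_pos; first by lra.
    by have := Rle_abs K; lra.
  move: (Rabs (G - A) * Rabs D) (Rabs (A * D - u)) (Rabs u ^ m.+2) H2.
  by move: (Rabs Cg * 2 ^ m.+2) (Rabs K) => *; lra.
- exists K; apply: filter_imp (locally_0_lt 1 Rlt_0_1) => u Hu.
  by apply: HK; lra.
- exists L, (Rmin d rho); split; first exact: Rmin_glb_lt.
  move=> x y Hx Hy; have l1 := Rmin_l d rho; have l2 := Rmin_r d rho.
  have [_ ->] := Hrho x ltac:(lra); have [_ ->] := Hrho y ltac:(lra).
  by apply: HL; lra.
Qed.

End Asymptotics.

(** * Consequences of a constant period *)

Section Isochrony.
Import GRing.Theory.
Local Open Scope ring_scope.
Local Open Scope R_scope.

Lemma isochronous_velocity (a : nat -> R) (g : R -> R) :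
  a 0%nat = 0 -> a 1%nat = 1 -> analytic_germ a g -> is_isochronous_center g ->
  exists (F : R -> R) (T d : R), [/\ forall u, continuous F u, F 0 = 1, 0 < d,
    forall c, 0 < c < d -> RInt (fun s => F (c * sin s)) 0 (2 * PI) = T
  & forall m, exists C, locally 0 (fun u => u <> 0 ->
      Rabs (F u - (series_pair (PS_Int a) m).2^`().[u]) <= C * Rabs u ^ m.+1)].
Proof.
move=> a0 a1 ag [_ [eps [T [eps0 HT]]]].
have [V [dV [r [r0 V0 dV0 [HV cV bV Hg]]]]] := normalizing_coordinate a g a0 a1 ag.
have half : 0 < / 2 by lra.
have Vlow z : / 2 <= dV z by case: (bV z).
have [X [VX XV dX]] := inverse_C1 V dV (/ 2) half HV cV Vlow.
have X0 : X 0 = 0 by rewrite -{1}V0 XV.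
have gap x y := abs_derive_gap V dV (/ 2) x y HV half Vlow.
have bX u : Rabs (X u) <= 2 * Rabs u.
  by have := gap 0 (X u); rewrite V0 VX !Rminus_0_r; lra.
pose F u := / dV (X u).
have cF u : continuous F u.
  apply: (continuous_comp (fun u => dV (X u)) Rinv); last first.
    by apply: continuous_Rinv; have := Vlow (X u); lra.
  apply: continuous_comp; last exact: cV.
  by apply: ex_derive_continuous; exists (/ dV (X u)); exact: dX.
have bF u : / 2 <= F u <= 2.
  rewrite /F; have := bV (X u) => ?; split.
    by apply: Rinv_le_contravar; lra.
  by rewrite -[X in _ <= X]Rinv_inv; apply: Rinv_le_contravar; lra.
have HgF u : Rabs u < r / 2 -> g (X u) * F u = u.
  move=> Hu; have HXu : Rabs (X u) < r by have := bX u; lra.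
  have [<- _] := Hg _ HXu; rewrite VX /F; field; have := Vlow (X u); lra.
(* The bound |X u| <= 2 |u| explains r / 2, and 5 c^2 < 9 c^2 < eps^2 explains eps / 3. *)
exists F, T, (Rmin (r / 2) (eps / 3)); split=> //.
- by rewrite /F X0 dV0 Rinv_1.
- by apply: Rmin_glb_lt; lra.
- move=> c Hc; have l1 := Rmin_l (r / 2) (eps / 3); have l2 := Rmin_r (r / 2) (eps / 3).
  have Hc' : 0 < c < r / 2 by lra.
  have [x [y [orb bxy minT]]] := orbit_of_angle g X F (r / 2) c dX cF bF X0 HgF Hc'.
  symmetry; apply: minT; apply: HT => // t.
  by have := bxy t; nra.
move=> m; apply: (series_pair_velocity a g V) => //.
exact: filter_imp (locally_0_lt r r0).
Qed.

(** [sigma i] is the coefficient of u^(i+2) in X. If those of smaller odd index vanish, then for odd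
    i the sum F u + F (- u) - 2 is 2 (i + 2) sigma_i u^(i+1) up to O(u^(i+2)), and a constant period
    excludes such a leading term. *)
Lemma isochronous_defect (a : nat -> R) (g : R -> R) (m : nat) :
  a 0%nat = 0 -> a 1%nat = 1 -> analytic_germ a g -> is_isochronous_center g ->
  odd m -> PS_Int a m.+3 = - defect R (series_pair (PS_Int a) m) m.
Proof.
move=> a0 a1 ag iso.
have [F [T [d [cF F0 d0 HT HF]]]] := isochronous_velocity a g a0 a1 ag iso.
pose b := PS_Int a; pose sigma i := - (defect R (series_pair b i) i + b i.+3).
pose Q i := (series_pair b i).2.
have QS i u : (Q i.+1)^`().[u] = (Q i)^`().[u] + sigma i * (INR i.+2 * u ^ i.+1).
  have -> : Q i.+1 = GRing.add (Q i) (sigma i *: 'X^(i.+2)).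
    by rewrite /sigma scaleNr.
  rewrite derivD derivZ derivXn hornerD hornerZ hornerMn hornerXn [i.+2.-1]/= -mulr_natl -INRE.
  by rewrite RpowE -RplusE -!RmultE.
have pow_odd i u : odd i -> (- u) ^ i = - u ^ i.
  by move=> oi; rewrite !RpowE RoppE exprNn -signr_odd oi expr1 mulN1r.
have pow_even i u : ~~ odd i -> (- u) ^ i = u ^ i.
  by move=> oi; rewrite !RpowE RoppE exprNn -signr_odd (negbTE oi) expr0 mul1r.
have even_part i : (forall j, (j < i)%nat -> odd j -> sigma j = 0) ->
    forall u, (Q i)^`().[u] + (Q i)^`().[- u] = 2.
  elim: i => [|i IH] Hi u; first by rewrite /Q /= derivX !hornerC; change (1 + 1 = 2); lra.
  have {}IH := IH (fun j ji => Hi j (ltnW ji)) u.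
  rewrite !QS; case: (boolP (odd i)) => oi; first by rewrite (Hi i) //; lra.
  by rewrite pow_odd //; lra.
suff main : forall i, odd i -> sigma i = 0.
  by move=> om; have := main m om; rewrite /sigma /b; lra.
elim/ltn_ind => i IH oi.
(* The pair of index i + 1 is the first to contain [sigma i], and its error has order i + 2, one
   beyond the term to be killed. *)
have [C [e HC]] := HF i.+1.
have := constant_period_even_part F T (2 * (INR i.+2 * sigma i)) (2 * C) (Rmin d e) i.+1 cF F0.
have e0 := cond_pos e; have l1 := Rmin_l d e; have l2 := Rmin_r d e.
move=> H; have : 2 * (INR i.+2 * sigma i) = 0.
  apply: H; first exact: Rmin_glb_lt.
    by move=> c Hc; apply: HT; lra.
  move=> u Hu.
  have Bu : ball 0 e u by apply/ball_RE; rewrite Rminus_0_r Rabs_right; lra.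
  have BNu : ball 0 e (- u) by apply/ball_RE; rewrite Rminus_0_r Rabs_Ropp Rabs_right; lra.
  have H1 := HC u Bu ltac:(lra); have H2 := HC (- u) BNu ltac:(lra).
  have := even_part i IH u.
  rewrite -/b -/(Q _) !QS in H1 H2; rewrite Rabs_Ropp (Rabs_right u) in H1 H2; try lra.
  rewrite pow_even in H2; last by rewrite /= oi.
  move: H1 H2.
  set A := (Q i)^`().[u]; set B := (Q i)^`().[- u]; set W := u ^ i.+1; set Z := u ^ i.+2.
  move=> H1 H2 E.
  have := Rabs_triang (F u - (A + sigma i * (INR i.+2 * W))) (F (- u) - (B + sigma i * (INR i.+2 * W))).
  have -> : F u - (A + sigma i * (INR i.+2 * W)) + (F (- u) - (B + sigma i * (INR i.+2 * W))) =
    F u + F (- u) - (A + B) - 2 * (INR i.+2 * sigma i) * W by ring.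
  by rewrite E; lra.
have : 0 < INR i.+2 by apply: lt_0_INR; apply/ltP.
by move=> n0 E; apply: (Rmult_eq_reg_l (INR i.+2)); lra.
Qed.

End Isochrony.

(** * Odd and even parts of the potential *)

Lemma sum_n_single (u : nat -> R) (o : nat) :
  (forall n, (n < o)%nat -> u n = 0) -> sum_n u o = u o.
Proof.
elim: o => [|o IH] H; first by rewrite sum_O.
rewrite sum_Sn IH => [|n no]; last exact: H (ltnW no).
by rewrite H // /plus /= Rplus_0_l.
Qed.

(** The skipped terms vanish, so the thinned partial sums form a subsequence of the original ones.
    This identifies [G1] and [G2] with power series, to which uniqueness of coefficients applies. *)
Lemma is_series_stride2 (u : nat -> R) (o : nat) (l : R) :
  (forall n, (n < o)%nat -> u n = 0) -> (forall j, u (2 * j + o).+1 = 0) ->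
  is_series u l -> is_series (fun j => u (2 * j + o)%nat) l.
Proof.
move=> H0 H1 Hu; have E j : sum_n (fun j => u (2 * j + o)%nat) j = sum_n u (2 * j + o)%nat.
  elim: j => [|j IH]; first by rewrite sum_O muln0 add0n sum_n_single.
  rewrite sum_Sn IH mulnS -addnA !addSn add0n !sum_Sn H1.
  by rewrite /plus /= Rplus_0_r.
change (is_lim_seq (sum_n (fun j => u (2 * j + o)%nat)) l).
apply: (is_lim_seq_ext (fun j => sum_n u (2 * j + o)%nat)) => [j|]; first by rewrite E.
apply: (is_lim_seq_subseq (sum_n u) l (fun j => 2 * j + o)%nat) => //.
apply: eventually_subseq => j; apply/ltP.
by rewrite ltn_add2r ltn_mul2l ltnS leqnn.
Qed.

Lemma is_pseries_dominated (b c : nat -> R) (x : R) :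
  (forall n, Rabs (c n) <= Rabs (b n)) -> Rbar_lt (Rabs x) (CV_radius b) ->
  is_pseries c x (PSeries c x).
Proof.
move=> Hc Hx; apply: PSeries_correct; apply: CV_disk_correct.
apply: ex_series_le (CV_disk_inside b x Hx) => n.
rewrite /norm /= /abs /= Rabs_Rabsolu !Rabs_mult; apply: Rmult_le_compat_r => //.
exact: Rabs_pos.
Qed.

Lemma is_pseries_is_series (c : nat -> R) (x l : R) :
  is_pseries c x l -> is_series (fun n => c n * x ^ n) l.
Proof.
by apply: is_series_ext => n; rewrite pow_n_pow /scal /= /mult /= Rmult_comm.
Qed.

Definition odd_part (b : nat -> R) (n : nat) : R := if odd n && (2 < n)%nat then b n else 0.
Definition even_part (b : nat -> R) (n : nat) : R := if ~~ odd n && (3 < n)%nat then b n else 0.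

Lemma G1_PSeries (a : nat -> R) (x : R) : Rbar_lt (Rabs x) (CV_radius a) ->
  is_pseries (odd_part (PS_Int a)) x (G1 a x).
Proof.
rewrite -CV_radius_Int => Hx.
have H : is_pseries (odd_part (PS_Int a)) x (PSeries (odd_part (PS_Int a)) x).
  apply: is_pseries_dominated Hx => n; rewrite /odd_part; case: ifP => _; first by right.
  by rewrite Rabs_R0; exact: Rabs_pos.
suff -> : G1 a x = PSeries (odd_part (PS_Int a)) x by [].
apply: is_series_unique.
have := is_series_stride2 _ 3 _ _ _ (is_pseries_is_series _ _ _ H).
move=> Hs; apply: is_series_ext (Hs _ _) => [j|n n3|j].
- rewrite /odd_part mul2n oddD odd_double /= addn3 /=.
  by rewrite addn2.
- by rewrite /odd_part [(2 < n)%nat]ltnNge -ltnS n3 andbF Rmult_0_l.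
- by rewrite /odd_part mul2n -addnS oddD odd_double /= Rmult_0_l.
Qed.

Lemma G2_PSeries (a : nat -> R) (x : R) : Rbar_lt (Rabs x) (CV_radius a) ->
  is_pseries (even_part (PS_Int a)) x (G2 a x).
Proof.
rewrite -CV_radius_Int => Hx.
have H : is_pseries (even_part (PS_Int a)) x (PSeries (even_part (PS_Int a)) x).
  apply: is_pseries_dominated Hx => n; rewrite /even_part; case: ifP => _; first by right.
  by rewrite Rabs_R0; exact: Rabs_pos.
suff -> : G2 a x = PSeries (even_part (PS_Int a)) x by [].
apply: is_series_unique.
have := is_series_stride2 _ 4 _ _ _ (is_pseries_is_series _ _ _ H).
move=> Hs; apply: is_series_ext (Hs _ _) => [j|n n3|j].
- rewrite /even_part mul2n oddD odd_double /= addn4 /=.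
  by rewrite addn3.
- by rewrite /even_part [(3 < n)%nat]ltnNge -ltnS n3 andbF Rmult_0_l.
- by rewrite /even_part mul2n -addnS oddD odd_double /= Rmult_0_l.
Qed.

Lemma PS_Int_split (a : nat -> R) (x : R) : a 0%nat = 0 -> a 1%nat = 1 ->
  Rbar_lt (Rabs x) (CV_radius a) -> PSeries (PS_Int a) x = x ^ 2 / 2 + G1 a x + G2 a x.
Proof.
move=> a0 a1 Hx; apply: is_pseries_unique.
pose e n := if n == 2%nat then / 2 else 0.
have He : is_pseries e x (x ^ 2 / 2).
  apply: (is_series_ext (fun n => e n * x ^ n)) => [n|].
    by rewrite pow_n_pow /scal /= /mult /= Rmult_comm.
  change (is_lim_seq (sum_n (fun n => e n * x ^ n)) (x ^ 2 / 2)).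
  apply/(is_lim_seq_incr_n _ 2).
  apply: (is_lim_seq_ext (fun _ => x ^ 2 / 2)) => [n|]; last exact: is_lim_seq_const.
  rewrite plusE addn2; elim: n => [|n IH].
    by rewrite !sum_Sn sum_O /plus /e /=; field.
  by rewrite sum_Sn -IH /e /plus /=; ring.
have H := is_pseries_plus _ _ _ _ _ (is_pseries_plus _ _ _ _ _ He (G1_PSeries a x Hx)) (G2_PSeries a x Hx).
apply: is_pseries_ext H => n; rewrite /PS_plus /plus /= /e /odd_part /even_part.
case: n => [|[|[|n]]] /=; rewrite ?a0 ?a1 ?Rplus_0_r /=; try field.
case: n => [|n] /=; first by ring.
by rewrite !ltnS !leq0n !andbT; case: (odd n) => /=; ring.
Qed.

Lemma germ_eq_0_coef (c : nat -> R) (G : R -> R) (rho : R) :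
  0 < rho -> (forall x, Rabs x <= rho -> is_pseries c x (G x)) ->
  (germ_eq G (fun _ => 0) <-> forall n, c n = 0).
Proof.
move=> rho0 HG; split=> [H n|Hc].
- apply: (PSeries_ext_recip c (fun _ => 0)).
  + apply: (ex_pseries_CV_radius c rho); first lra.
    by exists (G rho); apply: HG; rewrite Rabs_right; lra.
  + by rewrite CV_radius_const_0.
  + apply: filter_imp (locally_and_0 _ _ H (locally_0_lt rho rho0)) => x [Gx Hx].
    rewrite PSeries_const_0 -Gx; apply: is_pseries_unique; apply: HG; lra.
- apply: filter_imp (locally_0_lt rho rho0) => x Hx.
  rewrite -(is_pseries_unique _ _ _ (HG x (Rlt_le _ _ Hx))).
  by rewrite (PSeries_ext c (fun _ => 0)) ?PSeries_const_0.
Qed.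

(** * The coefficient relations and the rigidity of the harmonic potential *)

Lemma isochronous_odd_coef (a : nat -> R) (g : R -> R) (k : nat) :
  a 0%nat = 0 -> a 1%nat = 1 -> analytic_germ a g -> is_isochronous_center g ->
  (1 <= k)%nat ->
  a (2 * k + 1)%nat =
  rat_poly_eval (isochronous_poly k) (fun i : 'I_k => a (2 * (k - i))%nat).
Proof.
move=> a0 a1 ag iso k1; set v := fun i : 'I_k => _.
pose m := (2 * k).-1.
have mS : m.+1 = (2 * k)%nat by rewrite prednK // muln_gt0.
have om : odd m by rewrite -[odd m]negbK -[~~ odd m]/(odd m.+1) mS mul2n odd_double.
have defm : rat_poly_eval (defect _ (universal_pair k m) m) v =
    defect R (series_pair (PS_Int a) m) m.
  apply: eval_universal_defect => [||i _ _|i _ oi].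
  - by rewrite -mS.
  - by rewrite [LHS]/PS_Int a1 /Rdiv Rmult_1_l.
  - by [].
  - exact: (isochronous_defect a g).
have H := isochronous_defect a g m a0 a1 ag iso om.
have E : rat_poly_eval (isochronous_poly k) v = - (INR (2 * k).+2 * defect R (series_pair (PS_Int a) m) m).
  rewrite -defm /rat_poly_eval /isochronous_poly -/m.
  by rewrite !(GRing.rmorphN, GRing.rmorphM, GRing.rmorph_nat) INRE.
rewrite E addn1; move: H; rewrite /PS_Int -/(PS_Int a) mS => H.
have n0 : INR (2 * k).+2 <> 0 by apply: not_0_INR.
have -> : a (2 * k).+1 = INR (2 * k).+2 * (a (2 * k).+1 / INR (2 * k).+2) by field.
rewrite H; ring.
Qed.

(** As long as all coefficients vanish, the recursion stays at (x^2 / 2, u), whose defect is 0;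
    isochrony then makes the next coefficient of even degree vanish as well. *)
Lemma odd_part_all_0 (a : nat -> R) (g : R -> R) :
  a 0%nat = 0 -> a 1%nat = 1 -> analytic_germ a g -> is_isochronous_center g ->
  (forall n, odd_part (PS_Int a) n = 0) -> forall n, PS_Int a n.+3 = 0.
Proof.
move=> a0 a1 ag iso Ho; elim/ltn_ind => n IH.
case: (boolP (odd n)) => on; last first.
  by have := Ho n.+3; rewrite /odd_part /= negbK on.
rewrite (isochronous_defect a g) // /series_pair normal_pair_trivial.
  by rewrite /defect /= comp_polyXr coefZ coefXn /= RoppE GRing.mulr0 GRing.oppr0.
by move=> i /IH.
Qed.

(** A first nonzero coefficient in degree n + 3 would show up squared in the defect of step 2 n + 1.
    That defect is minus the coefficient of x^(2n+4), which belongs to the even part whatever the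
    parity of n. *)
Lemma even_part_all_0 (a : nat -> R) (g : R -> R) :
  a 0%nat = 0 -> a 1%nat = 1 -> analytic_germ a g -> is_isochronous_center g ->
  (forall n, even_part (PS_Int a) n = 0) -> forall n, PS_Int a n.+3 = 0.
Proof.
move=> a0 a1 ag iso He; elim/ltn_ind => n IH.
apply: (normal_pair_leading _ (PS_Int a)) => //.
- by rewrite /PS_Int a0 /Rdiv Rmult_0_l.
- by change (PS_Int a 2%nat + PS_Int a 2%nat = 1); rewrite /PS_Int a1 /=; field.
have om : odd (n + n).+1 by rewrite addnn /= odd_double.
have H := isochronous_defect a g _ a0 a1 ag iso om.
have ev : ~~ odd (n + n).+4 && (3 < (n + n).+4)%nat by rewrite addnn /= odd_double.
have := He (n + n).+4; rewrite /even_part ev H => E.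
by change (defect R (series_pair (PS_Int a) (n + n).+1) (n + n).+1 = 0); lra.
Qed.

Theorem theoremC :
  exists f : forall k : nat, {mpoly rat[k]},
    forall (a : nat -> R) (g : R -> R),
      a 0%nat = 0 -> a 1%nat = 1 -> analytic_germ a g ->
      germ_eq (potential g) (fun x : R => x ^ 2 / 2 + G1 a x + G2 a x) /\
      (is_isochronous_center g ->
        (forall k : nat, (1 <= k)%nat ->
           a (2 * k + 1)%nat
           = rat_poly_eval (f k) (fun i : 'I_k => a (2 * (k - i))%nat)) /\
        (germ_eq (G2 a) (fun _ : R => 0) <-> germ_eq (G1 a) (fun _ : R => 0)) /\
        (germ_eq (G1 a) (fun _ : R => 0)
         <-> germ_eq (potential g) (fun x : R => x ^ 2 / 2))).
Proof.
exists isochronous_poly => a g a0 a1 ag.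
have [rho [rho0 Hrho]] := analytic_germ_PSeries a g ag.
have HG1 x : Rabs x <= rho -> is_pseries (odd_part (PS_Int a)) x (G1 a x).
  by move=> /Hrho [Hx _]; exact: G1_PSeries.
have HG2 x : Rabs x <= rho -> is_pseries (even_part (PS_Int a)) x (G2 a x).
  by move=> /Hrho [Hx _]; exact: G2_PSeries.
have pot : germ_eq (potential g) (fun x : R => x ^ 2 / 2 + G1 a x + G2 a x).
  apply: filter_imp (locally_0_lt rho rho0) => x Hx.
  have [Hr _] := Hrho x (Rlt_le _ _ Hx).
  rewrite -PS_Int_split // -RInt_PSeries //; apply: RInt_ext => z Hz.
  have Hzr : Rabs z <= rho.
    move: Hz; have /Rabs_def2 := Hx; rewrite /Rmin /Rmax.
    by case: Rle_dec => ? ? ?; apply: Rabs_le; lra.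
  by have [] := Hrho z Hzr.
split=> // iso; split; first by move=> k; exact: (isochronous_odd_coef a g).
have odd0 := germ_eq_0_coef _ _ rho rho0 HG1.
have even0 := germ_eq_0_coef _ _ rho rho0 HG2.
have oall : germ_eq (G1 a) (fun _ => 0) -> forall n, PS_Int a n.+3 = 0.
  by move/odd0; exact: (odd_part_all_0 a g).
have eall : germ_eq (G2 a) (fun _ => 0) -> forall n, PS_Int a n.+3 = 0.
  by move/even0; exact: (even_part_all_0 a g).
have all_odd : (forall n, PS_Int a n.+3 = 0) -> germ_eq (G1 a) (fun _ => 0).
  by move=> H; apply/odd0 => -[|[|[|n]]] //; rewrite /odd_part H; case: ifP.
have all_even : (forall n, PS_Int a n.+3 = 0) -> germ_eq (G2 a) (fun _ => 0).
  by move=> H; apply/even0 => -[|[|[|n]]] //; rewrite /even_part H; case: ifP.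
split; first by split=> [/eall|/oall].
split=> [H1|Hp].
  have H2 := all_even (oall H1).
  apply: filter_imp (locally_and_0 _ _ pot (locally_and_0 _ _ H1 H2)) => x [-> [-> ->]].
  by rewrite !Rplus_0_r.
have sum0 : germ_eq (fun x => G1 a x + G2 a x) (fun _ => 0).
  by apply: filter_imp (locally_and_0 _ _ pot Hp) => x [-> ?]; lra.
(* The two series have no exponent in common, so the vanishing of their sum forces that of each
   coefficient of [G1]. *)
have HG x : Rabs x <= rho ->
    is_pseries (PS_plus (odd_part (PS_Int a)) (even_part (PS_Int a))) x (G1 a x + G2 a x).
  by move=> Hx; apply: is_pseries_plus; [exact: HG1|exact: HG2].
have coef0 := proj1 (germ_eq_0_coef _ _ rho rho0 HG) sum0.
apply/odd0 => n; have := coef0 n; rewrite /PS_plus /plus /= /odd_part /even_part.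
by case: (odd n) => //=; rewrite Rplus_0_r.
Qed.
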